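(* Let $\alpha\in(0,1]$, let $\Omega\subset\mathbb{R}^N$, $N\ge2$, be a strictly convex bounded domain and let $g:\partial\Omega\to\mathbb{R}$ be continuous. Then the $\alpha$-convex envelope $u^*_\alpha$ of $g$ is continuous in $\overline{\Omega}$ and is the unique viscosity solution $u$, continuous on $\overline{\Omega}$, of $$\begin{cases}\mathcal{L}_\alpha u(z)=\displaystyle\inf_{|v|=1}\Big\{\alpha\langle D^2u(z)v,v\rangle+(1-\alpha)|\langle Du(z),v\rangle|^2\Big\}=0, & z\in\Omega,\\ u(z)=g(z), & z\in\partial\Omega.\end{cases}$$
   Context: $\Omega$ is strictly convex if $tx+(1-t)y\in\Omega$ for every $x,y\in\overline{\Omega}$, $x\ne y$, and $t\in(0,1)$. For a function $v$ of one variable, $L_\alpha(v)(t)=\alpha v''(t)+(1-\alpha)|v'(t)|^2$. A function $u:\overline{\Omega}\to\mathbb{R}$ is $\alpha$-convex ($\alpha\in(0,1]$) if for any $x,y\in\overline{\Omega}$ one has $u(tx+(1-t)y)\le v(t)$ for all $t\in(0,1)$, where $v$ is the (unique classical) solution of $L_\alpha(v)=0$ in $(0,1)$ with $v(0)=u(y)$, $v(1)=u(x)$. The $\alpha$-convex envelope of $g$ is $$u^*_\alpha(z)=\sup\{v(z): v:\overline{\Omega}\to\mathbb{R}\text{ is }\alpha\text{-convex and } v|_{\partial\Omega}\le g\},\qquad z\in\overline{\Omega}.$$ Viscosity solutions of $\mathcal{L}_\alpha u=0$ in $\Omega$ are understood as follows. Subsolution: $u$ is upper semicontinuous and for any $z\in\Omega$,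 any $x,y\in\Omega$ and $t_0\in(0,1)$ with $z=t_0x+(1-t_0)y$, and any $\phi\in C^2(\mathbb{R})$ with $\phi(t_0)=u(z)$ and $\phi(t)\ge u(tx+(1-t)y)$ for $t\in(0,1)$, one has $L_\alpha\phi(t_0)\ge0$. Supersolution: $u$ is lower semicontinuous and for any $z\in\Omega$ and any $\phi\in C^2(\Omega)$ with $\phi(z)=u(z)$ and $\phi\le u$ in $\Omega$, one has $\mathcal{L}_\alpha\phi(z)=\inf_{|v|=1}\{\alpha\langle D^2\phi(z)v,v\rangle+(1-\alpha)|\langle D\phi(z),v\rangle|^2\}\le0$. A viscosity solution is both a viscosity subsolution and a viscosity supersolution. *)

(* Defs.v *)
From HB Require Import structures.
From mathcomp Require Import all_boot all_order all_algebra.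
From mathcomp Require Import all_classical all_reals all_analysis.

Set Implicit Arguments.
Unset Strict Implicit.
Unset Printing Implicit Defensive.

Import Order.TTheory GRing.Theory Num.Theory.
Import numFieldNormedType.Exports.

Local Open Scope classical_set_scope.
Local Open Scope ring_scope.

(* Functions on a subset of R^N are represented by total functions on
   'rV[R]_N of which only the values on that subset are ever used. *)

Section Euclidean.
Context {R : realType} {N : nat}.
Implicit Types (A : set 'rV[R]_N) (f : 'rV[R]_N -> R) (x y z v : 'rV[R]_N).

(* The library norm of 'rV[R]_N is the sup norm, hence the explicit
   Euclidean inner product and norm. *)
Definition dotp x y : R := \sum_(i < N) x 0 i * y 0 i.

Definition enorm x : R := Num.sqrt (dotp x x).

Definition boundary A : set 'rV[R]_N := closure A `\` A°.

Definition strictly_convex A : Prop :=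
  forall x y, closure A x -> closure A y -> x != y ->
  forall t : R, 0 < t < 1 -> A (t *: x + (1 - t) *: y).

Definition domain A : Prop := [/\ open A, connected A & A !=set0].

Definition partial (i : 'I_N) f : 'rV[R]_N -> R := 'D_(delta_mx 0 i) f.

(* The C^k classes are meant for open A. *)
Definition C1_on A f : Prop :=
  {within A, continuous f} /\
  forall i, (forall z, A z -> derivable f z (delta_mx 0 i)) /\
            {within A, continuous (partial i f)}.

Definition C2_on A f : Prop :=
  C1_on A f /\ forall i, C1_on A (partial i f).

Definition grad f z : 'rV[R]_N := \row_i partial i f z.

Definition hess f z : 'M[R]_N := \matrix_(i, j) partial i (partial j f) z.

(* <D^2 f(z) v, v> is written with row vectors: v *m hess f z. *)
Definition calL (alpha : R) f z : R :=
  inf [set alpha * dotp (v *m hess f z) v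
           + (1 - alpha) * `|dotp (grad f z) v| ^+ 2 | v in [set v | enorm v = 1]].

End Euclidean.

Section OneVariable.
Context {R : realType}.
Implicit Types (A : set R) (v : R -> R).

Definition C2_line A v : Prop :=
  [/\ {within A, continuous v},
      (forall t, A t -> derivable v t 1) /\ {within A, continuous (derive1 v)}
    & (forall t, A t -> derivable (derive1 v) t 1) /\
      {within A, continuous (derive1 (derive1 v))}].

Definition Lalpha (alpha : R) v (t : R) : R :=
  alpha * derive1 (derive1 v) t + (1 - alpha) * `|derive1 v t| ^+ 2.

Definition Lalpha_solution (alpha a b : R) v : Prop :=
  [/\ {within `[0, 1], continuous v},
      C2_line `]0, 1[ v,
      (forall t, 0 < t < 1 -> Lalpha alpha v t = 0)
    & v 0 = a /\ v 1 = b].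

End OneVariable.

(* Mirror image of the library's lower_semicontinuous. *)
Definition upper_semicontinuous {R : realType} {X : topologicalType}
    (f : X -> \bar R) : Prop :=
  forall x (a : R), (f x < a%:E)%E ->
    exists2 V, nbhs x V & forall y, V y -> (f y < a%:E)%E.

Section Envelope.
Context {R : realType} {N : nat}.
Variables (alpha : R) (Omega : set 'rV[R]_N).
Implicit Types (u g : 'rV[R]_N -> R) (x y z : 'rV[R]_N).

(* The two-point problem has exactly one solution on [0, 1], so quantifying
   over all v amounts to naming that solution. *)
Definition alpha_convex u : Prop :=
  forall x y, closure Omega x -> closure Omega y ->
  forall v : R -> R, Lalpha_solution alpha (u y) (u x) v ->
  forall t, 0 < t < 1 -> u (t *: x + (1 - t) *: y) <= v t.

Definition envelope g z : R :=
  sup [set v z | v in [set v : 'rV[R]_N -> R |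
    alpha_convex v /\ forall x, boundary Omega x -> v x <= g x]].

Definition viscosity_subsolution u : Prop :=
  upper_semicontinuous (fun z : subspace Omega => (u z)%:E) /\
  forall z x y (t0 : R), Omega z -> Omega x -> Omega y -> 0 < t0 < 1 ->
    z = t0 *: x + (1 - t0) *: y ->
  forall phi : R -> R, C2_line setT phi -> phi t0 = u z ->
    (forall t, 0 < t < 1 -> u (t *: x + (1 - t) *: y) <= phi t) ->
    0 <= Lalpha alpha phi t0.

Definition viscosity_supersolution u : Prop :=
  lower_semicontinuous (fun z : subspace Omega => (u z)%:E) /\
  forall z, Omega z ->
  forall phi : 'rV[R]_N -> R, C2_on Omega phi -> phi z = u z ->
    (forall w, Omega w -> phi w <= u w) ->
    calL alpha phi z <= 0.

Definition viscosity_solution u : Prop :=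
  viscosity_subsolution u /\ viscosity_supersolution u.

Definition dirichlet_solution g u : Prop :=
  [/\ {within closure Omega, continuous u}, viscosity_solution u
    & forall z, boundary Omega z -> u z = g z].

End Envelope.

(* Main.v *)
Require Import Defs.
From HB Require Import structures.
From mathcomp Require Import all_boot all_order all_algebra.
From mathcomp Require Import all_classical all_reals all_analysis.
From mathcomp Require Import ring lra.
Set Implicit Arguments.
Unset Strict Implicit.
Unset Printing Implicit Defensive.
Import Order.TTheory GRing.Theory Num.Theory.
Import numFieldNormedType.Exports.
Local Open Scope classical_set_scope.
Local Open Scope ring_scope.

(* With kappa = (1 - alpha)/alpha, the increasing function T with
   T' = exp (kappa s) satisfies alpha T'' = (1 - alpha) T', so that
   alpha (T o v)'' = T'(v) L_alpha(v): solutions of L_alpha v = 0 are the v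
   with T o v affine, u is alpha-convex iff T o u is convex, and T o u*_alpha
   is the convex envelope of T o g.  Supporting hyperplanes of the strictly
   convex domain give affine barriers at each boundary point, whence continuity
   and the boundary values of the envelope E = T o u*_alpha.
   If a C^2 function T o phi touches E from below at z, the affine function l
   through (z, E z) with slope D (T o phi)(z) meets T o g at some boundary point
   x (otherwise l could be raised); by convexity E <= l on the segment from z
   to x, so the second derivative of T o phi in the direction x - z is <= 0.
   For uniqueness, subsolutions are alpha-convex, hence below the envelope.
   Conversely E is a supremum of affine functions l <= T o g; if T o u < l
   somewhere, then l + eps |x|^2 minus a constant touches T o u from below at
   an interior point, and an explicit quartic polynomial of that function is an
   admissible test function for u violating the supersolution property. *)

(** * The change of unknown on the line *)

Section Calculus.
Context {R : realType}.
Implicit Types (f g : R -> R) (x y : R).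

Lemma is_derive_continuous f x (df : R) : is_derive x 1 f df -> {for x, continuous f}.
Proof. by move=> H; apply/differentiable_continuous/derivable1_diffP; case: H. Qed.

Lemma MVT_closed f (df : R -> R) (a b : R) : a < b ->
  (forall x, a <= x <= b -> is_derive x 1 f (df x)) ->
  exists2 c, a < c < b & f b - f a = df c * (b - a).
Proof.
move=> ab H; have [||c cab E] := @MVT R f df a b ab.
- by move=> x; rewrite in_itv/= => /andP[/ltW ? /ltW ?]; apply: H; apply/andP.
- apply: continuous_in_subspaceT => x; rewrite inE/= in_itv/= => xab.
  exact: is_derive_continuous (H x xab).
- by exists c => //; move: cab; rewrite in_itv.
Qed.

(** Carathéodory's form of the derivative gives [f1 z = h z * (z - x)] with [h] positive near [x].
    The mean value theorem then yields [f y - f x = h c * (c - x) * (y - x)] with [c] between [x]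
    and [y]. All second-order tests below go through this lemma. *)
Lemma second_order_strict_min f (f1 : R -> R) x (f2 : R) :
  (\forall y \near x, is_derive (y : R) 1 f (f1 y)) -> is_derive x 1 f1 f2 ->
  f1 x = 0 -> 0 < f2 ->
  exists2 r : R, 0 < r & forall y, 0 < `|y - x| < r -> f x < f y.
Proof.
move=> /nbhs_normP[r0 /= r0_gt0 Hr0] /is_derive1_caratheodory[h [hE hc h0]] f1x f2_gt0.
have : \forall y \near x, 0 < h y.
  by have /cvgrPdist_lt /(_ _ f2_gt0) := hc; apply: filterS => y /=; rewrite h0 ltr_norml; lra.
move=> /nbhs_normP[r1 /= r1_gt0 Hr1].
exists (Num.min r0 r1) => [|y]; first by rewrite lt_min r0_gt0.
rewrite lt_min normr_gt0 subr_eq0 => /and3P[yx yr0 yr1].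
have D z : `|z - x| <= `|y - x| -> is_derive z 1 f (f1 z).
  by move=> zy; apply: Hr0; rewrite /= /ball_/= distrC (le_lt_trans zy).
have P z : `|z - x| <= `|y - x| -> 0 < h z.
  by move=> zy; apply: Hr1; rewrite /= /ball_/= distrC (le_lt_trans zy).
have E z : f1 z = h z * (z - x) by rewrite -hE f1x subr0.
move: yx; rewrite neq_lt => /orP[yx|xy].
- have [|c /andP[c1 c2] Ec] := @MVT_closed f f1 y x yx.
    move=> z /andP[z1 z2]; apply: D.
    by rewrite ler0_norm ?ler0_norm; lra.
  have := P c _; rewrite ler0_norm ?ler0_norm; [|lra|lra] => /(_ ltac:(lra)) hc0.
  rewrite -subr_lt0 -oppr_gt0 opprB in Ec *.
  have -> : f y - f x = h c * ((x - c) * (x - y)) by rewrite -[LHS]opprB Ec E; ring.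
  by rewrite !mulr_gt0 //; lra.
- have [|c /andP[c1 c2] Ec] := @MVT_closed f f1 x y xy.
    move=> z /andP[z1 z2]; apply: D.
    by rewrite ger0_norm ?ger0_norm; lra.
  have := P c _; rewrite ger0_norm ?ger0_norm; [|lra|lra] => /(_ ltac:(lra)) hc0.
  rewrite -subr_gt0.
  by rewrite Ec E !mulr_gt0 //; lra.
Qed.

End Calculus.

Section Linearization.
Context {R : realType}.
Variable alpha : R.
Hypothesis halpha : 0 < alpha <= 1.
Implicit Types s y a : R.

Definition kap : R := (1 - alpha) / alpha.
Definition linD (s : R) : R := expR (kap * s).
(** The value [kap = 0] is the case [alpha = 1], where the identity replaces the quotient; both
    branches have derivative [linD]. *)
Definition linT (s : R) : R := if kap == 0 then s else linD s / kap.
(** For [kap > 0] the range of [linT] is the positive half-line, so this is a left inverse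
    everywhere but a right inverse only on that range. *)
Definition linS (y : R) : R := if kap == 0 then y else ln (kap * y) / kap.

Lemma kap_ge0 : 0 <= kap.
Proof.
by case/andP: halpha => a0 a1; rewrite divr_ge0 ?subr_ge0// ltW.
Qed.

Lemma alpha_kap : alpha * kap = 1 - alpha.
Proof.
by case/andP: halpha => a0 a1; rewrite mulrCA divff ?mulr1// gt_eqF.
Qed.

Lemma linD_gt0 s : 0 < linD s.
Proof. exact: expR_gt0. Qed.

Lemma is_derive_linD s : is_derive s 1 linD (kap * linD s).
Proof.
have H : is_derive s 1 (fun s => kap * s) kap.
  by apply: is_derive_eq; rewrite ?derive_id; rewrite -[RHS]mulr1.
by have := is_derive1_comp (is_derive_expR (kap * s)) H; rewrite mulrC.
Qed.

Lemma is_derive_linT s : is_derive s 1 linT (linD s).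
Proof.
rewrite /linT; have [k0|k0] := eqVneq kap 0.
  rewrite /linD k0 mul0r expR0; exact: is_derive_id.
have := is_deriveZ kap^-1 (is_derive_linD s).
have -> : kap^-1 *: (kap * linD s) = linD s by rewrite /GRing.scale/= mulKf.
by congr is_derive; apply/funext => t; rewrite mulrC.
Qed.

Lemma linTK s : linS (linT s) = s.
Proof.
rewrite /linS /linT; have [//|k0] := eqVneq kap 0.
by rewrite mulrCA divff// mulr1 expRK mulrC mulKf.
Qed.

Lemma linT_lt : {mono linT : x y / x < y}.
Proof.
have H : {homo linT : x y / x < y}.
  move=> x y xy; have [c _] := MVT_closed xy (fun z _ => is_derive_linT z).
  by rewrite -subr_gt0 => ->; rewrite mulr_gt0 ?linD_gt0 ?subr_gt0.
exact: leW_mono (le_mono H).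
Qed.

Lemma linT_le : {mono linT : x y / x <= y}.
Proof. by move=> x y; rewrite !leNgt linT_lt. Qed.

(** A value of [linT] below [y] places [y] in the range of [linT], uniformly in [kap]. *)
Lemma linSK a y : linT a <= y -> linT (linS y) = y.
Proof.
rewrite /linS /linT; have [//|k0] := eqVneq kap 0.
have k_gt0 : 0 < kap by rewrite lt_neqAle eq_sym k0 kap_ge0.
move=> ay; have y0 : 0 < y by rewrite (lt_le_trans _ ay)// divr_gt0 ?linD_gt0.
rewrite /linD mulrCA divff// mulr1 lnK ?posrE ?(mulr_gt0 k_gt0 y0)//.
by rewrite mulrC mulKf.
Qed.

Lemma is_derive_linS a y : linT a < y -> is_derive y 1 linS (linD (linS y))^-1.
Proof.
move=> ay; rewrite -{1}(linSK (ltW ay)); apply: is_derive_inverse.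
- by near=> t; rewrite linTK.
- by near=> t; apply: is_derive_continuous (is_derive_linT _).
- exact: is_derive_linT.
- by rewrite gt_eqF// linD_gt0.
Unshelve. all: by end_near. Qed.

Lemma linT_continuous : continuous linT.
Proof. by move=> x; apply: is_derive_continuous (is_derive_linT _). Qed.

End Linearization.

Section SmoothLine.
Context {R : realType}.
Implicit Types (v : R -> R) (t : R).

Lemma C2_lineI (A : set R) v (v1 v2 : R -> R) : open A ->
  (forall t, A t -> is_derive t 1 v (v1 t)) ->
  (forall t, A t -> is_derive t 1 v1 (v2 t)) ->
  (forall t, A t -> {for t, continuous v2}) ->
  C2_line A v /\ forall t, A t ->
    derive1 v t = v1 t /\ derive1 (derive1 v) t = v2 t.
Proof.
move=> oA Dv Dv1 cv2.
have E1 t : A t -> derive1 v t = v1 t by move=> At; rewrite derive1E; case: (Dv t At).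
have Dv1' t : A t -> is_derive t 1 (derive1 v) (v2 t).
  move=> At; apply: near_eq_is_derive (Dv1 t At).
  by near=> s; rewrite E1//; near: s; exact: open_nbhs_nbhs.
have E2 t : A t -> derive1 (derive1 v) t = v2 t.
  by move=> At; rewrite derive1E; case: (Dv1' t At).
split; last by move=> t At; rewrite E1// E2.
split; [|split|split].
- rewrite continuous_open_subspace// => t; rewrite inE => At.
  exact: is_derive_continuous (Dv t At).
- by move=> t At; case: (Dv t At).
- rewrite continuous_open_subspace// => t; rewrite inE => At.
  exact: is_derive_continuous (Dv1' t At).
- by move=> t At; case: (Dv1' t At).
- apply: (@subspace_eq_continuous _ A _ v2); first by move=> t /set_mem At; exact/esym/E2.
  by rewrite continuous_open_subspace// => t; rewrite inE => At; exact: cv2.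
Unshelve. all: by end_near. Qed.

End SmoothLine.

(** * The two-point problem, and polynomial substitutes for the inverse of [T] *)

Section TwoPoint.
Context {R : realType}.
Variable alpha : R.
Hypothesis halpha : 0 < alpha <= 1.
Implicit Types (a b c s t x y : R).
Notation D := (linD alpha).
Notation T := (linT alpha).
Notation S := (linS alpha).
Notation kappa := (kap alpha).

(** The solution is [S] applied to the affine interpolation of [T a] and [T b]. *)
Lemma two_point_solution a b :
  exists2 v, Lalpha_solution alpha a b v &
    forall t, 0 <= t <= 1 -> T (v t) = t * T b + (1 - t) * T a.
Proof.
(* As [m] is below both data, [l] stays strictly above [T m] on the closed interval, hence where [S]
   is differentiable. *)
pose l t := t * T b + (1 - t) * T a; pose m := Num.min a b - 1.
have ma : T m < T a by rewrite linT_lt// /m; have : Num.min a b <= a by [rewrite ge_min lexx]; lra.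
have mb : T m < T b by rewrite linT_lt// /m; have : Num.min a b <= b by [rewrite ge_min lexx orbT]; lra.
have lm t : 0 <= t <= 1 -> T m < l t.
  move=> /andP[t0 t1]; rewrite /l; have [->|tn] := eqVneq t 0; first by lra.
  have : 0 < t * (T b - T m) by rewrite mulr_gt0 ?subr_gt0// lt_neqAle eq_sym tn.
  have : 0 <= (1 - t) * (T a - T m) by rewrite mulr_ge0 ?subr_ge0// ltW.
  lra.
have Dl t : is_derive t 1 l (T b - T a).
  have -> : l = (T b - T a) *: (id : R -> R) + cst (T a).
    by apply/funext => s; rewrite /l !fctE /GRing.scale/=; ring.
  by apply: is_derive_eq; rewrite addr0 /GRing.scale/= mulr1.
pose v := S \o l; pose v1 t := (D (v t))^-1 * (T b - T a).
(* This is the equation solved for the second derivative, [v'' = - kappa * v' ^+ 2]. *)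
pose v2 t := - kappa * v1 t ^+ 2.
have Dv t : T m < l t -> is_derive t 1 v (v1 t).
  by move=> mt; apply: is_derive1_comp; exact: is_derive_linS mt.
have Dv1 t : T m < l t -> is_derive t 1 v1 (v2 t).
  move=> mt; have := is_derive1_comp (is_derive_linD alpha (v t)) (Dv t mt).
  have D0 : (D \o v) t != 0 by rewrite gt_eqF// linD_gt0.
  move=> /(is_deriveV D0) /(is_deriveZ (T b - T a)).
  have -> : (T b - T a) \*: (fun y : R => ((D \o v) y)^-1) = v1.
    by apply/funext => s; rewrite /v1 /= mulrC.
  move=> H; apply: is_derive_eq H _; rewrite /v2 /v1 /= /GRing.scale /=.
  by field.
have [C2v Ev] : C2_line `]0, 1[ v /\ forall t, (`]0, 1[)%classic t ->
    derive1 v t = v1 t /\ derive1 (derive1 v) t = v2 t.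
  have H t : (`]0, 1[)%classic t -> T m < l t.
    by rewrite /= in_itv/= => /andP[/ltW ? /ltW ?]; apply: lm; apply/andP.
  apply: (@C2_lineI _ _ v v1 v2) => [|t /H/Dv//|t /H/Dv1//|t /H mt].
    exact: interval_open.
  have := is_derive_continuous (Dv1 _ mt) => cv1.
  by apply: cvgM; [exact: cvg_cst|exact: (cvgM cv1 cv1)].
have vE t : 0 <= t <= 1 -> T (v t) = l t by move=> /lm/ltW; exact: linSK.
exists v => //; split=> //.
- apply: continuous_in_subspaceT => t; rewrite inE/= in_itv/= => t01.
  exact: is_derive_continuous (Dv _ (lm _ t01)).
- move=> t t01; have [|E1 E2] := Ev t; first by rewrite /= in_itv.
  rewrite /Lalpha E1 E2 real_normK ?num_real// /v2 -alpha_kap//; ring.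
- by split; [rewrite /v /= /l mul0r add0r subr0 mul1r linTK|
             rewrite /v /= /l mul1r subrr mul0r addr0 linTK].
Qed.

Implicit Type v : R -> R.

Lemma is_derive_linT_comp v (v1 : R) t :
  is_derive t 1 v v1 -> is_derive t 1 (T \o v) (D (v t) * v1).
Proof. by move=> Dv; apply: is_derive1_comp; exact: is_derive_linT. Qed.

Lemma is_derive_linT_comp2 v (v1 : R -> R) (v2 : R) t :
  is_derive t 1 v (v1 t) -> is_derive t 1 v1 v2 ->
  is_derive t 1 (fun s => D (v s) * v1 s) (D (v t) * (kappa * v1 t ^+ 2 + v2)).
Proof.
move=> Dv Dv1.
have := is_deriveM (is_derive1_comp (is_derive_linD alpha (v t)) Dv) Dv1.
by move=> H; apply: is_derive_eq H _; rewrite /GRing.scale /=; ring.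
Qed.

(** The second derivative of [T \o v] is [D v * (kappa * v' ^+ 2 + v'')], and [alpha] times the
    second factor is [Lalpha alpha v = 0]. So [T \o v] has constant slope on the open interval, and
    continuity carries the affine formula to the endpoints. *)
Lemma two_point_unique a b v : Lalpha_solution alpha a b v ->
  forall t, 0 <= t <= 1 -> T (v t) = t * T b + (1 - t) * T a.
Proof.
case=> cv [_ [dv _] [ddv _]] Lv [v0 v1].
pose F := T \o v; pose F1 t := D (v t) * derive1 v t.
have DF t : 0 < t < 1 -> is_derive t 1 F (F1 t).
  move=> t01; apply: is_derive_linT_comp.
  by rewrite derive1E; apply/derivableP/dv; rewrite /= in_itv.
have DF1 t : 0 < t < 1 -> is_derive t 1 F1 0.
  move=> t01; have Dv : is_derive t 1 v (derive1 v t).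
    by rewrite derive1E; apply/derivableP/dv; rewrite /= in_itv.
  have Ddv : is_derive t 1 (derive1 v) (derive1 (derive1 v) t).
    by rewrite derive1E; apply/derivableP/ddv; rewrite /= in_itv.
  apply: is_derive_eq (is_derive_linT_comp2 Dv Ddv) _.
  apply: (mulfI (_ : alpha != 0)); first by case/andP: halpha => /gt_eqF->.
  have := Lv t t01; rewrite /Lalpha real_normK ?num_real// -(alpha_kap halpha).
  by move=> E; rewrite mulr0 -[RHS](mulr0 (D (v t))) -E; ring.
have cF1 s t : 0 < s < 1 -> 0 < t < 1 -> F1 s = F1 t.
  wlog st : s t / s <= t.
    by move=> H s01 t01; case: (leP s t) => [st|/ltW ts]; [|symmetry]; exact: H.
  move=> /andP[s0 s1] /andP[t0 t1]; move: st; rewrite le_eqVlt => /predU1P[->//|st].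
  have [|c _ /eqP] := MVT_closed (f := F1) (df := fun=> 0) st.
    by move=> x /andP[sx xt]; apply: DF1; lra.
  by rewrite mul0r subr_eq0 => /eqP.
have cF : {within `[0, 1], continuous F}.
  by move=> t; exact: cvg_comp (cv t) (@linT_continuous _ alpha (v t)).
(* The point [2^-1] only serves to name the constant slope. *)
have mvt x y : 0 <= x -> x < y -> y <= 1 -> F y - F x = F1 2^-1 * (y - x).
  move=> x0 xy y1; have [||c] := @MVT R F F1 x y xy.
  - by move=> z; rewrite in_itv/= => /andP[? ?]; apply: DF; lra.
  - apply: continuous_subspaceW cF => z /=; rewrite !in_itv/= => /andP[? ?].
    by apply/andP; lra.
  - by rewrite in_itv/= => /andP[? ?] ->; congr (_ * _); apply: cF1; lra.
have F01 := mvt 0 1 (lexx _) ltr01 (lexx _).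
move=> t /andP[]; rewrite le_eqVlt => /predU1P[<- _|t0 t1].
  by rewrite v0 mul0r add0r subr0 mul1r.
have := mvt 0 t (lexx _) t0 t1; move: F01; rewrite /F /= v0 v1 !subr0 mulr1 => <-.
by move=> E; lra.
Qed.

(** The linear coefficient gives [T \o q] slope 1 at 0, and the second derivative there vanishes
    exactly for [e = kappa / 2 * (D c)^-2], when [q] is the second-order expansion of
    [S (T c + x)]. *)
Lemma is_derive_linT_parabola c e (q := fun x : R => c + (D c)^-1 * x - e * x ^+ 2) :
  (forall x, is_derive x 1 (T \o q) (D (q x) * ((D c)^-1 - 2 * e * x))) /\
  is_derive (0 : R) 1 (fun x => D (q x) * ((D c)^-1 - 2 * e * x))
    (kappa * (D c)^-1 - 2 * e * D c).
Proof.
have D0 : D c != 0 by rewrite gt_eqF// linD_gt0.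
have Dq x : is_derive x 1 q ((D c)^-1 - 2 * e * x).
  have -> : q = horner (c%:P + (D c)^-1 *: 'X - e *: 'X^2).
    by apply/funext => t; rewrite /q !hornerE.
  apply: is_derive_eq (is_derive_poly _ _) _.
    rewrite !(derivB, derivD, derivZ, derivC, derivX, derivXn) !hornerE; ring.
have Dl x : is_derive x 1 (fun x => (D c)^-1 - 2 * e * x) (- (2 * e)).
  have -> : (fun x => (D c)^-1 - 2 * e * x) = horner ((D c)^-1%:P - (2 * e) *: 'X).
    by apply/funext => t; rewrite !hornerE.
  apply: is_derive_eq (is_derive_poly _ _) _.
    rewrite !(derivB, derivD, derivZ, derivC, derivX, derivXn) !hornerE; ring.
split=> [x|]; first by apply: is_derive1_comp; exact: is_derive_linT.
have := is_deriveM (is_derive1_comp (is_derive_linD alpha (q 0)) (Dq 0)) (Dl 0).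
move=> H; apply: is_derive_eq H _; rewrite /GRing.scale /=.
have -> : q 0 = c by rewrite /q; ring.
by field.
Qed.

(** A polynomial majorant of [S (T c + x)], defined and smooth on the whole line. Lowering the
    critical quadratic coefficient by [d] puts [T] of the parabola strictly above [T c + x] near 0.
    The quartic term handles the remaining [x] and does not affect the derivatives at 0 up to order
    two. *)
Lemma linT_upper_test c d X : 0 < d -> 0 <= X ->
  exists2 K, 0 <= K & forall x, `|x| <= X ->
    T c + x <= T (c + (D c)^-1 * x - (kappa / 2 * (D c)^-2 - d) * x ^+ 2 + K * x ^+ 4).
Proof.
move=> d0 X0; set e := _ - d; set a := (D c)^-1.
have Dc0 : 0 < D c by exact: linD_gt0.
have a0 : 0 < a by rewrite invr_gt0.
pose q x := c + a * x - e * x ^+ 2.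
have [DT DT1] := is_derive_linT_parabola c e.
have [] := @second_order_strict_min R (fun x => T (q x) - x)
    (fun x => D (q x) * (a - 2 * e * x) - 1) 0 (kappa * a - 2 * e * D c).
- by near=> x; apply: is_deriveB; exact: DT.
- by rewrite -[X in is_derive _ _ _ X]subr0; apply: is_deriveB.
- by rewrite /q !mulr0 expr0n mulr0 !subr0 addr0 divff ?subrr// gt_eqF.
- have -> : kappa * a - 2 * e * D c = 2 * d * D c.
    by rewrite /e /a; field; rewrite gt_eqF.
  by rewrite !mulr_gt0.
move=> r r0 Hr.
(* The highest level to be dominated, corresponding to [x = X]. *)
pose Y := S (T c + X).
have TY : T Y = T c + X by apply: (linSK halpha (a := c)); lra.
(* [M] bounds [Y] minus the parabola when [|x| <= X], and [K * x ^+ 4 >= M] once [|x| >= r]. *)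
pose M := `|Y| + `|c| + a * X + `|e| * X ^+ 2.
have M0 : 0 <= M.
  by rewrite !addr_ge0 ?mulr_ge0 ?exprn_ge0 ?normr_ge0// ltW.
pose K := M / r ^+ 4.
have K0 : 0 <= K by rewrite divr_ge0// exprn_ge0// ltW.
exists K => // x xX; have [xr|rx] := ltP `|x| r.
  have [->|x0] := eqVneq x 0; first by rewrite !expr0n /= !(mulr0, subr0, addr0).
  have := Hr x; rewrite subr0 normr_gt0 x0 xr => /(_ isT).
  rewrite /q mulr0 expr0n mulr0 !(addr0, subr0) => /ltW H.
  apply: (@le_trans _ _ (T (q x))); first by rewrite -lerBrDr.
  by rewrite linT_le// lerDl mulr_ge0// exprn_even_ge0.
apply: (@le_trans _ _ (T Y)); first by rewrite TY lerD2l (le_trans _ xX)// ler_norm.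
rewrite linT_le//.
have KE : M <= K * x ^+ 4.
  rewrite /K mulrAC ler_pdivlMr ?exprn_gt0// ler_wpM2l//.
  by rewrite -[x ^+ 4]ger0_norm ?exprn_even_ge0// normrX lerXn2r ?nnegrE ?(ltW r0).
have H1 : - (a * X) <= a * x by rewrite -mulrN ler_pM2l//; move: xX; rewrite ler_norml => /andP[].
have H2 : e * x ^+ 2 <= `|e| * X ^+ 2.
  rewrite (le_trans (ler_norm _))// normrM ler_wpM2l// normrX lerXn2r ?nnegrE//.
have := ler_norm Y; have := ler_norm (- c); rewrite normrN => H3 H4.
by rewrite /M in KE; lra.
Unshelve. all: by end_near. Qed.

(** The mirror image of [linT_upper_test], except that [T c + x] may leave the range of [T], and
    then no value of [T] lies below it. Away from 0 the polynomial is therefore only pushed below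
    [m], which will be a lower bound of the function to be touched. *)
Lemma linT_lower_test c d X m : 0 < d -> 0 <= X ->
  exists2 K, 0 <= K & forall x, `|x| <= X ->
    T (c + (D c)^-1 * x - (kappa / 2 * (D c)^-2 + d) * x ^+ 2 - K * x ^+ 4)
      <= Num.max (T c + x) (T m).
Proof.
move=> d0 X0; set e := _ + d; set a := (D c)^-1.
have Dc0 : 0 < D c by exact: linD_gt0.
have a0 : 0 < a by rewrite invr_gt0.
pose q x := c + a * x - e * x ^+ 2.
have [DT DT1] := is_derive_linT_parabola c e.
have [] := @second_order_strict_min R (fun x => x - T (q x))
    (fun x => 1 - D (q x) * (a - 2 * e * x)) 0 (- (kappa * a - 2 * e * D c)).
- by near=> x; apply: is_deriveB; exact: DT.
- by rewrite -[X in is_derive _ _ _ X]sub0r; apply: is_deriveB.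
- by rewrite /q !mulr0 expr0n mulr0 !subr0 addr0 divff ?subrr// gt_eqF.
- have -> : - (kappa * a - 2 * e * D c) = 2 * d * D c.
    by rewrite /e /a; field; rewrite gt_eqF.
  by rewrite !mulr_gt0.
move=> r r0 Hr.
pose M := `|m| + `|c| + a * X + `|e| * X ^+ 2.
have M0 : 0 <= M.
  by rewrite !addr_ge0 ?mulr_ge0 ?exprn_ge0 ?normr_ge0// ltW.
pose K := M / r ^+ 4.
have K0 : 0 <= K by rewrite divr_ge0// exprn_ge0// ltW.
exists K => // x xX; rewrite le_max; apply/orP; have [xr|rx] := ltP `|x| r; [left|right].
  have [->|x0] := eqVneq x 0; first by rewrite !expr0n /= !(mulr0, subr0, addr0).
  have := Hr x; rewrite subr0 normr_gt0 x0 xr => /(_ isT).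
  rewrite /q mulr0 expr0n mulr0 !(addr0, subr0) sub0r => /ltW H.
  apply: (@le_trans _ _ (T (q x))); last by lra.
  by rewrite linT_le// gerBl mulr_ge0// exprn_even_ge0.
rewrite linT_le//.
have KE : M <= K * x ^+ 4.
  rewrite /K mulrAC ler_pdivlMr ?exprn_gt0// ler_wpM2l//.
  by rewrite -[x ^+ 4]ger0_norm ?exprn_even_ge0// normrX lerXn2r ?nnegrE ?(ltW r0).
have H1 : a * x <= a * X by rewrite ler_pM2l// (le_trans _ xX)// ler_norm.
have H2 : - (e * x ^+ 2) <= `|e| * X ^+ 2.
  rewrite (le_trans (ler_norm _))// normrN normrM ler_wpM2l// normrX lerXn2r ?nnegrE//.
have := ler_norm (- m); have := ler_norm c; rewrite normrN => H3 H4.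
by rewrite /M in KE; lra.
Unshelve. all: by end_near. Qed.

End TwoPoint.

(** * Convex functions and strictly convex domains *)

Lemma inf_leP (R : realType) (A : set R) (m x : R) :
  (forall y, A y -> m <= y) -> A x -> inf A <= x.
Proof. by move=> Am; apply: ge_inf; exists m. Qed.

Section Dotp.
Context {R : realType} {N : nat}.
Implicit Types (x y z b : 'rV[R]_N) (t : R).

Lemma dotpC x y : dotp x y = dotp y x.
Proof. by apply: eq_bigr => i _; rewrite mulrC. Qed.

Lemma dotpDr b x y : dotp b (x + y) = dotp b x + dotp b y.
Proof. by rewrite -big_split/=; apply: eq_bigr => i _; rewrite !mxE mulrDr. Qed.

Lemma dotpZr b t x : dotp b (t *: x) = t * dotp b x.
Proof. by rewrite big_distrr/=; apply: eq_bigr => i _; rewrite !mxE mulrCA. Qed.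

Lemma dotpNr b x : dotp b (- x) = - dotp b x.
Proof. by rewrite -scaleN1r dotpZr mulN1r. Qed.

Lemma dotpBr b x y : dotp b (x - y) = dotp b x - dotp b y.
Proof. by rewrite dotpDr dotpNr. Qed.

Lemma dotp0r b : dotp b 0 = 0.
Proof. by rewrite -(scale0r (0 : 'rV[R]_N)) dotpZr mul0r. Qed.

Lemma dotpZl b t x : dotp (t *: b) x = t * dotp b x.
Proof. by rewrite dotpC dotpZr dotpC. Qed.

Lemma dotp_ge0 x : 0 <= dotp x x.
Proof. by apply: sumr_ge0 => i _; rewrite -expr2 sqr_ge0. Qed.

Lemma dotp_gt0 x : x != 0 -> 0 < dotp x x.
Proof.
move=> x0; rewrite lt_neqAle dotp_ge0 andbT; apply: contra x0 => /eqP/esym x0.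
apply/eqP/rowP => i; apply/eqP; rewrite mxE -sqrf_eq0 expr2; move: x0 => /eqP.
rewrite psumr_eq0; last by move=> j _; rewrite -expr2 sqr_ge0.
by move=> /allP/(_ i); rewrite mem_index_enum => /(_ isT).
Qed.

Lemma dotp_delta x i : dotp x (delta_mx 0 i) = x 0 i.
Proof.
rewrite /dotp (bigD1 i)//= big1 ?addr0 => [|j ji]; first by rewrite mxE !eqxx mulr1.
by rewrite mxE eqxx (negbTE ji) mulr0.
Qed.

Lemma coord_le_norm x i : `|x 0 i| <= `|x|.
Proof.
rewrite [leRHS]/Num.norm/= mx_normrE.
by apply: (le_bigmax _ (fun i : 'I_1 * 'I_N => `|x i.1 i.2|) (0, i)).
Qed.

(** The l1 norm, dual to the sup norm that [|x|] denotes on row vectors. *)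
Definition dotp_bound b : R := \sum_i `|b 0 i|.

Lemma dotp_bound_ge0 b : 0 <= dotp_bound b.
Proof. exact: sumr_ge0. Qed.

Lemma dotp_le_bound b x : `|dotp b x| <= dotp_bound b * `|x|.
Proof.
rewrite /dotp_bound mulr_suml (le_trans (ler_norm_sum _ _ _))//.
by apply: ler_sum => i _; rewrite normrM ler_wpM2l// coord_le_norm.
Qed.

Lemma dotp_self_le x : dotp x x <= N%:R * `|x| ^+ 2.
Proof.
rewrite mulr_natl -[X in _ *+ X](card_ord N) -sumr_const.
apply: ler_sum => i _; rewrite -expr2 -real_normK ?num_real//.
by rewrite lerXn2r ?nnegrE ?coord_le_norm.
Qed.

Lemma enorm1_coord x i : enorm x = 1 -> `|x 0 i| <= 1.
Proof.
move=> /(congr1 (fun r => r ^+ 2)); rewrite expr1n sqr_sqrtr ?dotp_ge0// => x1.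
rewrite -(@ler_pXn2r _ 2)// ?nnegrE// expr1n real_normK ?num_real// -x1.
rewrite /dotp (bigD1 i)//= -expr2 lerDl; apply: sumr_ge0 => j _.
by rewrite -expr2 sqr_ge0.
Qed.

Lemma dotp_enorm1 b x : enorm x = 1 -> `|dotp b x| <= dotp_bound b.
Proof.
move=> x1; rewrite (le_trans (ler_norm_sum _ _ _))//; apply: ler_sum => i _.
by rewrite normrM -[leRHS]mulr1 ler_wpM2l// enorm1_coord.
Qed.

Lemma enorm_normalize x : x != 0 -> enorm ((enorm x)^-1 *: x) = 1.
Proof.
move=> x0; have e0 : enorm x != 0 by rewrite gt_eqF// sqrtr_gt0 dotp_gt0.
have xx : dotp x x = enorm x * enorm x by rewrite -expr2 sqr_sqrtr ?dotp_ge0.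
by rewrite {1}/enorm dotpZl dotpZr xx mulKf// mulVf// sqrtr1.
Qed.

End Dotp.

(** * The Hahn-Banach theorem in finite dimension *)

Section HahnBanach.
Context {R : realType} {N : nat}.
Implicit Types (p q : 'rV[R]_N -> R) (x y e b : 'rV[R]_N).

Definition sublinear p : Prop :=
  (forall x y, p (x + y) <= p x + p y) /\
  (forall s x, 0 < s -> p (s *: x) = s * p x).

Lemma sublinearI p : (forall x y, p (x + y) <= p x + p y) ->
  (forall s x, 0 < s -> p (s *: x) <= s * p x) -> sublinear p.
Proof.
move=> pD pZ; split=> // s x s0; apply/eqP; rewrite eq_le pZ//=.
have := pZ s^-1 (s *: x); rewrite invr_gt0 => /(_ s0).
by rewrite scalerA mulVf ?gt_eqF// scale1r mulrC ler_pdivlMr// mulrC.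
Qed.

Lemma sublinear0 p : sublinear p -> p 0 = 0.
Proof. by case=> _ /(_ 2 0 ltac:(lra)); rewrite scaler0; lra. Qed.

Lemma sublinearN p x : sublinear p -> - p (- x) <= p x.
Proof. by move=> sp; have := sp.1 x (- x); rewrite subrr sublinear0//; lra. Qed.

(** The infimum of [p (x + t *: e) - t * p e] over [t >= 0] works: [t = 0] gives [q <= p], and
    [t = 1] at [x = - e] gives the last clause. Together they give [q e + q (- e) <= 0], so [q] is
    linear along [e]. *)
Lemma sublinear_flatten p e : sublinear p ->
  exists q, [/\ sublinear q, forall x, q x <= p x & q (- e) <= - p e].
Proof.
move=> sp; have [pD pZ] := sp.
pose A x := [set p (x + t *: e) - t * p e | t in [set t : R | 0 <= t]].
have A0 x : A x !=set0 by exists (p (x + 0 *: e) - 0 * p e), 0 => /=.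
have lbA x z : A x z -> - p (- x) <= z.
  move=> [t /= t0 <-]; have := pD (x + t *: e) (- x).
  have -> : p (x + t *: e - x) = t * p e.
    rewrite addrAC subrr add0r; move: t0; rewrite le_eqVlt => /predU1P[<-|t0].
      by rewrite scale0r mul0r sublinear0.
    exact: pZ.
  lra.
have qle x t : 0 <= t -> inf (A x) <= p (x + t *: e) - t * p e.
  by move=> t0; apply: (inf_leP (@lbA x)); exists t.
exists (fun x => inf (A x)); split.
- apply: sublinearI => [x y|s x s0].
    rewrite -lerBlDr; apply: lb_le_inf => // _ [t /= t0 <-].
    rewrite lerBlDr -lerBlDl; apply: lb_le_inf => // _ [s /= s0 <-].
    rewrite lerBlDr (le_trans (qle (x + y) (t + s) (addr_ge0 t0 s0)))//.
    have -> : x + y + (t + s) *: e = (x + t *: e) + (y + s *: e).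
      by rewrite scalerDl addrACA.
    by have := pD (x + t *: e) (y + s *: e); lra.
  rewrite mulrC -ler_pdivrMr//; apply: lb_le_inf => // _ [t /= t0 <-].
  rewrite ler_pdivrMr// (le_trans (qle (s *: x) (s * t) _)) ?mulr_ge0 ?(ltW s0)//.
  by rewrite -scalerA -scalerDr pZ// -mulrA -mulrBr mulrC.
- by move=> x; have := qle x 0 (lexx _); rewrite scale0r addr0 mul0r subr0.
- by have := qle (- e) 1 ler01; rewrite scale1r addNr sublinear0// mul1r sub0r.
Qed.

(** Flattening along further vectors only decreases the function, so the inequality obtained for the
    earlier ones persists. *)
Lemma sublinear_flatten_seq (s : seq 'rV[R]_N) p : sublinear p ->
  exists q, [/\ sublinear q, forall x, q x <= p x &
    forall e, e \in s -> q e + q (- e) <= 0].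
Proof.
elim: s p => [|e s IH] p sp; first by exists p.
have [q [sq qp qe]] := sublinear_flatten e sp.
have [r [sr rq re]] := IH q sq; exists r; split=> // [x|x].
  exact: le_trans (rq x) (qp x).
rewrite inE => /predU1P[->|]; last exact: re.
by have := rq e; have := rq (- e); have := qp e; lra.
Qed.

(** Flattening first along [e] gives [p1 (- e) <= - p e]. Flattening then along the standard basis
    gives some [q] below the linear form of its values on the basis. Applied at [- x], the same
    bound together with [- q (- x) <= q x] makes [q] equal to that form. *)
Lemma hahn_banach p e : sublinear p ->
  exists2 b, (forall x, dotp b x <= p x) & p e <= dotp b e.
Proof.
move=> sp; have [p1 [sp1 p1p p1e]] := sublinear_flatten e sp.
have [q [sq qp1 qd]] :=
  sublinear_flatten_seq [seq (delta_mx 0 i : 'rV[R]_N) | i <- enum 'I_N] sp1.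
pose b : 'rV[R]_N := \row_i q (delta_mx 0 i).
have qdelta i (t : R) : q (t *: delta_mx 0 i) <= t * q (delta_mx 0 i).
  have := qd (delta_mx 0 i); rewrite map_f ?mem_enum// => /(_ isT) qi.
  have [t0|t0|->] := ltgtP t 0.
  - rewrite -[t]opprK scaleNr -scalerN sq.2 ?oppr_gt0//.
    by have := mulr_le0 (ltW t0) qi; rewrite opprK; lra.
  - by rewrite sq.2.
  - by rewrite scale0r mul0r sublinear0.
have qb x : q x <= dotp b x.
  rewrite {1}[x]row_sum_delta /dotp.
  elim/big_ind2 : _ => [|x1 x2 y1 y2 H1 H2|i _]; first by rewrite sublinear0.
    exact: le_trans (sq.1 _ _) (lerD H1 H2).
  by rewrite mxE mulrC qdelta.
exists b => [x|].
  have := qb (- x); rewrite dotpNr; have := sublinearN x sq.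
  by have := p1p x; have := qp1 x; lra.
by have := qb e; have := sublinearN e sq; have := qp1 (- e); lra.
Qed.

End HahnBanach.

(** * Affine minorants of convex functions *)

Section ConvexFunctions.
Context {R : realType} {N : nat}.
Implicit Types (A O : set 'rV[R]_N) (f : 'rV[R]_N -> R) (x y z e b : 'rV[R]_N).

Definition convex_on A f : Prop :=
  forall x y, A x -> A y -> forall t : R, 0 < t < 1 ->
    f (t *: x + (1 - t) *: y) <= t * f x + (1 - t) * f y.

Definition convex_dom A : Prop :=
  forall x y, A x -> A y -> forall t : R, 0 < t < 1 -> A (t *: x + (1 - t) *: y).

Lemma open_ray O z h : open O -> O z -> exists2 r : R, 0 < r &
  forall t : R, `|t| < r -> O (z + t *: h).
Proof.
move=> oO Oz; have /nbhs_normP[r /= r0 Hr] := open_nbhs_nbhs (conj oO Oz).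
have h1 : 0 < `|h| + 1 by rewrite ltr_wpDl.
exists (r / (`|h| + 1)) => [|t tr]; first by rewrite divr_gt0.
apply: Hr; rewrite /ball_/= opprD addNKr normrN normrZ.
move: tr; rewrite ltr_pdivlMr//; apply: le_lt_trans.
by rewrite ler_wpM2l// lerDl.
Qed.

(* The perspective function of [f - c] about [z] is sublinear: with [f = 1] and
   [c = 0] it is the gauge of [O], with [c = f z] its linear minorants are the
   subgradients of [f] at [z]. *)
Lemma convex_affine_minorant O f z c e M :
  open O -> convex_dom O -> convex_on O f -> O z -> c <= f z ->
  (forall s : R, 0 < s -> O (z + s^-1 *: e) -> M <= s * (f (z + s^-1 *: e) - c)) ->
  exists2 b, (forall x, O x -> c + dotp b (x - z) <= f x) & M <= dotp b e.
Proof.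
move=> oO cO cf Oz cz HM.
pose A (h : 'rV[R]_N) := [set s * (f (z + s^-1 *: h) - c) | s in
  [set s : R | 0 < s /\ O (z + s^-1 *: h)]].
have A0 h : A h !=set0.
  have [r r0 Hr] := open_ray h oO Oz.
  exists (2 / r * (f (z + (2 / r)^-1 *: h) - c)), (2 / r) => //=.
  split; first by rewrite divr_gt0.
  by apply: Hr; rewrite invf_div ger0_norm ?ltr_pdivrMr//; lra.
(* The point [z] lies between [z + s^-1 *: h] and the fixed point [z - k *: h], with weights
   [s * k / (s * k + 1)] and [(s * k + 1)^-1]; convexity there bounds the quotient from below
   independently of [s]. *)
have lbA h : exists m, forall w : R, A h w -> m <= w.
  have [r r0 Hr] := open_ray h oO Oz.
  pose k := r / 2; have k0 : 0 < k by rewrite divr_gt0.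
  have Oh : O (z - k *: h).
    by rewrite -scaleNr; apply: Hr; rewrite normrN ger0_norm /k; lra.
  exists (k^-1 * (f z - f (z - k *: h))) => _ [s /= [s0 Os] <-].
  have sk : 0 < s * k + 1 by rewrite ltr_wpDl// mulr_ge0 ?ltW.
  have := cf _ _ Os Oh (s * k / (s * k + 1)).
  rewrite divr_gt0 ?mulr_gt0// ltr_pdivrMr// mul1r ltrDl ltr01 => /(_ isT).
  have -> : 1 - s * k / (s * k + 1) = (s * k + 1)^-1 by field; rewrite gt_eqF.
  have -> : (s * k / (s * k + 1)) *: (z + s^-1 *: h) + (s * k + 1)^-1 *: (z - k *: h) = z.
    rewrite !scalerDr !scalerN !scalerA addrACA -scalerDl.
    have -> : s * k / (s * k + 1) + (s * k + 1)^-1 = 1 by field; rewrite gt_eqF.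
    have -> : s * k / (s * k + 1) / s = (s * k + 1)^-1 * k.
      by field; rewrite !gt_eqF.
    by rewrite scale1r subrr addr0.
  set F := f (z + _); set G := f (z - _) => H.
  have {}H : (s * k + 1) * f z <= s * k * F + G.
    have := H; rewrite -(ler_pM2l sk) => /le_trans; apply.
    by rewrite le_eqVlt; apply/orP; left; apply/eqP; field; rewrite gt_eqF.
  rewrite mulrC ler_pdivrMr//.
  by have := mulr_ge0 (ltW (mulr_gt0 s0 k0)) (_ : 0 <= f z - c); rewrite subr_ge0 => /(_ cz); lra.
pose p h := inf (A h).
have ple h s : 0 < s -> O (z + s^-1 *: h) -> p h <= s * (f (z + s^-1 *: h) - c).
  by move=> s0 Os; have [m Hm] := lbA h; apply: (inf_leP Hm); exists s.
have sp : sublinear p.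
  apply: sublinearI => [x y|s x s0].
    rewrite -lerBlDr; apply: lb_le_inf => // _ [t /= [t0 Ot] <-].
    rewrite lerBlDr -lerBlDl; apply: lb_le_inf => // _ [s /= [s0 Os] <-].
    have ts : 0 < t + s by rewrite addr_gt0.
    have l01 : 0 < t / (t + s) < 1 by rewrite divr_gt0//= ltr_pdivrMr// mul1r ltrDl.
    have lE : 1 - t / (t + s) = s / (t + s) by field; rewrite gt_eqF.
    (* Joint convexity of the perspective: the weights [t / (t + s)] and [s / (t + s)] combine the
       competitors for [x] and [y] into one for [x + y]. *)
    have E : z + (t + s)^-1 *: (x + y) =
        (t / (t + s)) *: (z + t^-1 *: x) + (1 - t / (t + s)) *: (z + s^-1 *: y).
      rewrite lE !scalerDr !scalerA addrACA -scalerDl -mulrDl mulfV ?gt_eqF// scale1r.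
      have -> : t / (t + s) / t = (t + s)^-1 by field; rewrite !gt_eqF.
      by have -> : s / (t + s) / s = (t + s)^-1 by field; rewrite !gt_eqF.
    have Oxy : O (z + (t + s)^-1 *: (x + y)) by rewrite E; exact: cO.
    have := cf _ _ Ot Os _ l01; rewrite -E lE => H.
    rewrite lerBlDl (le_trans (ple (x + y) _ ts Oxy))//.
    move: H; set F := f (z + t^-1 *: x); set G := f (z + s^-1 *: y).
    rewrite -(ler_pM2l ts).
    have -> : (t + s) * (t / (t + s) * F + s / (t + s) * G) = t * F + s * G.
      by field; rewrite gt_eqF.
    lra.
  rewrite mulrC -ler_pdivrMr//; apply: lb_le_inf => // _ [t /= [t0 Ot] <-].
  rewrite ler_pdivrMr//.
  have E : (t * s)^-1 *: (s *: x) = t^-1 *: x.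
    by rewrite scalerA invfM mulfVK// gt_eqF.
  have := ple (s *: x) (t * s) (mulr_gt0 t0 s0).
  by rewrite E => /(_ Ot) /le_trans; apply; rewrite mulrAC.
have [b bp eb] := hahn_banach e sp; exists b => [x Ox|].
  have := ple (x - z) 1 ltr01; rewrite invr1 scale1r addrC subrK mul1r => /(_ Ox).
  by have := bp (x - z); lra.
by apply: le_trans eb; apply: lb_le_inf => // _ [s /= [s0 Os] <-]; exact: HM.
Qed.

Lemma convex_subgradient O f z : open O -> convex_dom O -> convex_on O f -> O z ->
  exists b, forall x, O x -> f z + dotp b (x - z) <= f x.
Proof.
move=> oO cO cf Oz.
have [|b Hb _] := @convex_affine_minorant O f z (f z) 0 0 oO cO cf Oz (lexx _).
  by move=> s s0 _; rewrite scaler0 addr0 subrr mulr0.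
by exists b.
Qed.

End ConvexFunctions.
Section WithinContinuity.
Context {R : realType} {V : normedModType R}.
Implicit Types (A : set V) (f : V -> R).

Lemma within_continuousP A f : {within A, continuous f} <->
  forall x, A x -> forall e : R, 0 < e -> exists2 d : R, 0 < d &
    forall y, A y -> `|y - x| < d -> `|f y - f x| < e.
Proof.
rewrite subspace_continuousP; split=> [cf x Ax e e0|H x Ax].
  have /cvgrPdist_lt /(_ _ e0) := cf x Ax.
  rewrite /prop_near1 /= /within /= => /nbhs_normP[d d0 Hd].
  exists d => // y Ay yx; rewrite distrC.
  by apply: (Hd y) => //; rewrite /ball_/= distrC.
apply/cvgrPdist_lt => e e0; have [d d0 Hd] := H x Ax e e0.
rewrite /prop_near1 /= /within /=; apply/nbhs_normP; exists d => //= y.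
by rewrite /ball_/= distrC => yx Ay; rewrite distrC; exact: Hd.
Qed.

End WithinContinuity.

(** * Rays, supporting hyperplanes and barriers of a strictly convex domain *)

Section StrictlyConvexDomain.
Context {R : realType} {N : nat}.
Variable Omega : set 'rV[R]_N.
Hypotheses (oO : open Omega) (bO : bounded_set Omega) (sO : strictly_convex Omega).
Implicit Types (x y z v b : 'rV[R]_N).

Lemma domain_closure x : Omega x -> closure Omega x.
Proof. exact: subset_closure. Qed.

Lemma boundaryE x : boundary Omega x <-> closure Omega x /\ ~ Omega x.
Proof. by rewrite /boundary ((interior_id _).1 oO). Qed.

Lemma closure_case x : closure Omega x -> Omega x \/ boundary Omega x.
Proof. by move=> cx; have [|nx] := pselect (Omega x); [left|right; apply/boundaryE]. Qed.

Lemma convex_comb_same x (t : R) : t *: x + (1 - t) *: x = x.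
Proof. by rewrite -scalerDl addrC subrK scale1r. Qed.

Lemma convex_dom_closure : convex_dom (closure Omega).
Proof.
move=> x y cx cy t t01; have [->|xy] := eqVneq x y; first by rewrite convex_comb_same.
exact/domain_closure/sO.
Qed.

Lemma convex_dom_domain : convex_dom Omega.
Proof.
move=> x y Ox Oy t t01; have [->|xy] := eqVneq x y; first by rewrite convex_comb_same.
by apply: sO => //; exact: domain_closure.
Qed.

Lemma closure_bounded : exists2 M : R, 0 < M & forall x, closure Omega x -> `|x| <= M.
Proof.
have [M M0 HM] : exists2 M : R, 0 < M & forall x, Omega x -> `|x| <= M.
  have [M0 [_ H]] := bO; exists (`|M0| + 1); first by rewrite ltr_wpDl.
  by move=> x Ox; apply: H => //; rewrite ltr_pwDr// ler_norm.
exists (M + 1) => [|x cx]; first by rewrite addr_gt0.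
have [y [Oy /= xy]] := cx _ (@nbhsx_ballx _ _ x 1 ltr01).
move: xy; rewrite -ball_normE /= => xy; have := HM y Oy.
by have := ler_distD y x 0; rewrite !subr0; lra.
Qed.

Lemma closure_compact : compact (closure Omega).
Proof.
apply: bounded_closed_compact; last exact: closed_closure.
have [M M0 HM] := closure_bounded; exists M; split; first exact: num_real.
by move=> r Mr x cx; exact: le_trans (HM x cx) (ltW Mr).
Qed.

Lemma boundary_compact : compact (boundary Omega).
Proof.
rewrite /boundary setDE; apply: compact_closedI closure_compact _.
exact/open_closedC/open_interior.
Qed.

(** The parameter is the supremum of those for which the ray is in the closure. Closedness keeps the
    limit point in the closure, and openness of [Omega] would let the ray continue from an interior
    point. *)
Lemma ray_boundary z v : Omega z -> v != 0 ->
  exists2 s : R, 0 < s & boundary Omega (z + s *: v).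
Proof.
move=> Oz v0; pose B := [set s : R | 0 <= s /\ closure Omega (z + s *: v)].
have B0 : B 0 by split=> //; rewrite scale0r addr0; exact: domain_closure.
have ubB : has_ubound B.
  have [M M0 HM] := closure_bounded; exists ((M + `|z|) / `|v|) => s [s0 /HM H].
  rewrite ler_pdivlMr ?normr_gt0// -[s]ger0_norm// -normrZ.
  have -> : s *: v = (z + s *: v) - z by rewrite addrC addKr.
  by rewrite (le_trans (ler_normB _ _))// lerD2r.
have supB : has_sup B by split=> //; exists 0.
have [r0 r0_gt0 Hr0] := open_ray v oO Oz.
have sup_gt0 : 0 < sup B.
  apply: (@lt_le_trans _ _ (r0 / 2)); first by rewrite divr_gt0.
  apply: ub_le_sup => //; split; first by rewrite ltW// divr_gt0.
  by apply/domain_closure/Hr0; rewrite ger0_norm; lra.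
exists (sup B) => //; apply/boundaryE; split.
- have [//|nc] := pselect (closure Omega (z + sup B *: v)).
  have [r r_gt0 Hr] := open_ray v (closed_openC (@closed_closure _ Omega)) nc.
  have [s [s0 cs] rs] := sup_adherent r_gt0 supB.
  have sB : s <= sup B := ub_le_sup ubB (conj s0 cs).
  have := Hr (s - sup B); rewrite ler0_norm; last by lra.
  by move=> /(_ ltac:(lra)); rewrite -addrA -scalerDl [sup B + _]addrC subrK => /(_ cs).
- move=> Os; have [r r_gt0 Hr] := open_ray v oO Os.
  have : B (sup B + r / 2).
    split; first by rewrite addr_ge0 ?ltW// divr_gt0.
    rewrite scalerDl addrA; apply/domain_closure/Hr.
    by rewrite ger0_norm; lra.
  by move=> /(ub_le_sup ubB); lra.
Qed.

Lemma boundary_chord z v : Omega z -> v != 0 ->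
  exists x y (t : R), [/\ boundary Omega x, boundary Omega y, 0 < t < 1
    & z = t *: x + (1 - t) *: y].
Proof.
move=> Oz v0; have [s s0 bs] := ray_boundary Oz v0.
have [|r r0 br] := @ray_boundary z (- v) Oz; first by rewrite oppr_eq0.
exists (z + s *: v), (z + r *: - v), (r / (r + s)); split=> //.
  by rewrite divr_gt0 ?addr_gt0//= ltr_pdivrMr ?addr_gt0// mul1r ltrDl.
have -> : 1 - r / (r + s) = s / (r + s) by field; rewrite gt_eqF ?addr_gt0.
rewrite !scalerDr !scalerA addrACA -scalerDl -mulrDl mulfV ?gt_eqF ?addr_gt0// scale1r.
by rewrite scalerN mulrAC [s / _ * r]mulrAC [s * r]mulrC subrr addr0.
Qed.

(** The gauge of [Omega] about [z] is at least 1 at [x0 - z], since otherwise [x0] would be in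
    [Omega]. This yields [b] with [dotp b (x - z) <= 1] on [Omega] and [dotp b (x0 - z) >= 1]. The
    midpoint [w] of [x] and [x0] is in [Omega], and pushing it slightly away from [z] makes the
    inequality strict at [w]. *)
Lemma supporting_vector x0 : Omega !=set0 -> boundary Omega x0 ->
  exists b, forall x, closure Omega x -> x != x0 -> dotp b (x - x0) < 0.
Proof.
move=> [z Oz] /boundaryE[cx0 nOx0].
have zx0 : z != x0 by apply: contra_notN nOx0 => /eqP <-.
have gauge_ge1 s : 0 < s -> Omega (z + s^-1 *: (x0 - z)) -> 1 <= s * (1 - 0).
  move=> s0 Os; rewrite subr0 mulr1 leNgt; apply/negP => s1; apply: nOx0.
  have -> : x0 = s *: (z + s^-1 *: (x0 - z)) + (1 - s) *: z.
    by apply/rowP => i; rewrite !mxE; field; rewrite gt_eqF.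
  by apply: convex_dom_domain => //; rewrite s0.
have cst1 : convex_on Omega (fun=> 1) by move=> x y _ _ t _; rewrite !mulr1 addrC subrK.
have [b Hb b1] := convex_affine_minorant oO convex_dom_domain cst1 Oz ler01 gauge_ge1.
exists b => x cx xx0.
have Ow : Omega (2^-1 *: x + (1 - 2^-1) *: x0) by apply: sO => //; lra.
set w := _ + _ in Ow.
have [r r0 Hr] := open_ray (w - z) oO Ow.
have rw : 0 < r / 2 by rewrite divr_gt0.
have Owr : Omega (w + (r / 2) *: (w - z)) by apply: Hr; rewrite ger0_norm; lra.
have := Hb _ Owr.
have -> : w + (r / 2) *: (w - z) - z = (1 + r / 2) *: (w - z).
  by rewrite addrAC scalerDl scale1r.
rewrite dotpZr add0r => H.
have wlt1 : dotp b (w - z) < 1.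
  rewrite ltNge; apply/negP => H1.
  have := mulr_ge0 (ltW rw) (_ : 0 <= dotp b (w - z) - 1); rewrite subr_ge0 => /(_ H1).
  by lra.
have -> : x - x0 = 2 *: (w - x0) by apply/rowP => i; rewrite !mxE; field.
rewrite dotpZr pmulr_rlt0//.
have -> : w - x0 = (w - z) - (x0 - z) by rewrite opprB addrA subrK.
by rewrite dotpBr; lra.
Qed.

(** Near [x0] continuity of [G] suffices, as the linear term has the right sign. On the compact rest
    [C] of the boundary that term has a positive minimum [m], so multiplying [b] by [M / m]
    dominates the oscillation [M] of [G]. *)
Lemma boundary_barrier (G : 'rV[R]_N -> R) x0 (e : R) : Omega !=set0 ->
  {within boundary Omega, continuous G} -> boundary Omega x0 -> 0 < e ->
  exists b, forall x, boundary Omega x -> `|G x - G x0| <= e - dotp b (x - x0).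
Proof.
move=> O0 cG bx0 e0; have [b Hb] := supporting_vector O0 bx0.
have bc x : boundary Omega x -> closure Omega x by case/boundaryE.
have [d d0 Hd] := (within_continuousP _ _).1 cG x0 bx0 e e0.
pose C := boundary Omega `&` ~` ball x0 d.
have cC : compact C by apply: compact_closedI boundary_compact _; exact/open_closedC/ball_open.
have nearG x : boundary Omega x -> ~ C x -> `|G x - G x0| < e.
  move=> bx nCx; apply: Hd => //; rewrite distrC.
  have [|nb] := pselect (ball x0 d x); first by rewrite -ball_normE.
  by exfalso; apply: nCx; split.
have nb x : boundary Omega x -> 0 <= - dotp b (x - x0).
  move=> bx; have [->|xx0] := eqVneq x x0; first by rewrite subrr dotp0r oppr0.
  by rewrite oppr_ge0 ltW// Hb//; exact: bc.
have [C0|C0] := pselect (C !=set0); last first.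
  exists 0 => x bx; rewrite -(scale0r 0) dotpZl mul0r subr0 ltW//.
  by apply: nearG => // Cx; apply: C0; exists x.
have cG' : {within C, continuous (fun x => `|G x - G x0|)}.
  have cGC : {within C, continuous G} by apply: continuous_subspaceW cG; exact: subIsetl.
  by move=> x; apply: cvg_norm; apply: cvgB; [exact: cGC|exact: cvg_cst].
have [xM _ HM] := compact_EVT_max C0 cC cG'.
have cb : {within C, continuous (fun x => - dotp b (x - x0))}.
  apply/within_continuousP => x _ r r0.
  exists (r / (dotp_bound b + 1)); first by rewrite divr_gt0// ltr_wpDl// dotp_bound_ge0.
  move=> y _; rewrite ltr_pdivlMr ?ltr_wpDl ?dotp_bound_ge0// => yx.
  rewrite opprK addrC -dotpBr opprB addrA subrK (le_lt_trans (dotp_le_bound _ _))//.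
  by rewrite distrC; move: yx; rewrite mulrDr mulr1 mulrC; apply: le_lt_trans; rewrite lerDl.
have [xm xmC Hm] := compact_EVT_min C0 cC cb.
move: xmC; rewrite inE => -[bxm nxm].
have m0 : 0 < - dotp b (xm - x0).
  rewrite oppr_gt0 Hb//; first exact: bc.
  by apply/negP => /eqP E; apply: nxm; rewrite E; exact: ballxx.
set m := - dotp b (xm - x0) in m0 Hm; set M := `|G xM - G x0| in HM.
exists ((M / m) *: b) => x bx; rewrite dotpZl -mulrN.
have M0 : 0 <= M / m by rewrite divr_ge0 ?(ltW m0)// /M normr_ge0.
have [Cx|nCx] := pselect (C x); last first.
  by have := nearG x bx nCx; have := mulr_ge0 M0 (nb x bx); lra.
rewrite (le_trans (HM x _)) ?inE// (le_trans _ (_ : M / m * m <= _))//.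
  by rewrite divfK// gt_eqF.
have := ler_wpM2l M0 (Hm x _); rewrite inE => /(_ Cx); lra.
Qed.

End StrictlyConvexDomain.

(** * Directional derivatives of C^2 functions *)

Section DirectionalDerivatives.
Context {R : realType} {V : normedModType R}.
Implicit Types (f : V -> R) (x y z u v w : V).

(** The two difference quotients are the same function of [h]. *)
Lemma is_derive_lineP f x v (s d : R) :
  is_derive (s *: v + x) v f d <-> is_derive s 1 (fun t : R => f (t *: v + x)) d.
Proof.
pose g := fun t : R => f (t *: v + x).
have E : (fun h : R => h^-1 *: ((f \o shift (s *: v + x)) (h *: v) - f (s *: v + x))) =
  (fun h : R => h^-1 *: ((g \o shift s) (h *: 1) - g s)).
  by apply/funext => h /=; rewrite /g scalerDl addrA [_%:A]mulr1.
have E1 : derivable f (s *: v + x) v = derivable g s 1 by rewrite /derivable E.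
have E2 : 'D_v f (s *: v + x) = 'D_1 g s by rewrite /derive E.
split=> -[d1 d2]; apply: DeriveDef.
- by rewrite -E1.
- by rewrite -E2.
- by rewrite E1.
- by rewrite E2.
Qed.

Lemma is_derive_scale_dir f x v (c d : R) :
  is_derive x v f d -> is_derive x (c *: v) f (c * d).
Proof.
move=> H; have -> : x = 0 *: (c *: v) + x by rewrite scale0r add0r.
apply/is_derive_lineP.
pose m := fun t : R => t * c.
have Hm : is_derive (0 : R) 1 m c.
  have -> : m = c *: (id : R -> R) by apply/funext => t; rewrite /m mulrC.
  by apply: is_derive_eq; rewrite /GRing.scale/= mulr1.
have H0 : is_derive (m 0) 1 (fun t : R => f (t *: v + x)) d.
  by apply/is_derive_lineP; rewrite /m mul0r scale0r add0r.
have := @is_derive1_comp _ _ m 0 d c H0 Hm; rewrite mulrC.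
by congr is_derive; apply/funext => t; rewrite /m /= scalerA.
Qed.

Lemma MVT_between (g dg : R -> R) (h : R) :
  (forall s : R, `|s| <= `|h| -> is_derive s 1 g (dg s)) ->
  exists2 c, `|c| <= `|h| & g h - g 0 = dg c * h.
Proof.
move=> H; have [h0|h0|->] := ltgtP h 0; last 1 first.
- by exists 0; rewrite // mulr0 subrr.
- have [s /andP[s1 s2]|c /andP[c1 c2] E] := @MVT_closed R g dg h 0 h0.
    by apply: H; rewrite !ler0_norm// ?lerN2// ltW.
  exists c; first by rewrite !ler0_norm// ?lerN2 ltW.
  by move: E; rewrite sub0r; lra.
- have [s /andP[s1 s2]|c /andP[c1 c2] E] := @MVT_closed R g dg 0 h h0.
    by apply: H; rewrite !ger0_norm// ltW.
  exists c; first by rewrite !ger0_norm// ltW.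
  by rewrite E subr0.
Qed.

(** The increment along [h *: (u + w)] splits into one along [h *: w] from [z] and one along
    [h *: u] from [z + h *: w]. The mean value theorem rewrites the second as ['D_u f] at a nearby
    point, where continuity applies. *)
Lemma is_derive_add_dir f z u w (dw : R) :
  (\forall y \near z, derivable f y u) -> {for z, continuous ('D_u f)} ->
  is_derive z w f dw -> is_derive z (u + w) f ('D_u f z + dw).
Proof.
move=> /nbhs_normP[r0 /= r0_gt0 Dr] cD [dfw Dw].
set q := fun h : R => h^-1 *: ((f \o shift z) (h *: (u + w)) - f z).
suff Hq : q h @[h --> 0^'] --> 'D_u f z + dw.
  by apply: DeriveDef; [apply: cvgP Hq|exact: cvg_lim Hq].
apply/cvgrPdist_lt => e e0; have e2 : 0 < e / 2 by rewrite divr_gt0.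
have /cvgrPdist_lt /(_ _ e2) /nbhs_normP[r1 /= r1_gt0 Hr1] := cD.
have /cvgrPdist_lt /(_ _ e2) Hw : h^-1 *: ((f \o shift z) (h *: w) - f z) @[h --> 0^'] --> dw.
  by rewrite -Dw; exact: dfw.
(* Dividing by [n] keeps all intermediate points [s *: u + (h *: w + z)] within [r] of [z]. *)
pose r := Num.min r0 r1; pose n := `|u| + `|w| + 1.
have n0 : 0 < n by rewrite ltr_wpDl// addr_ge0.
have r_gt0 : 0 < r by rewrite lt_min r0_gt0.
have small : \forall h \near 0^', `|h : R| < r / n.
  by apply: dnbhs0_lt; rewrite divr_gt0.
near=> h.
have h0 : h != 0 by near: h; exact: nbhs_dnbhs_neq.
have hr : `|h| < r / n by near: h.
have close (s : R) : `|s| <= `|h| -> `|z - (s *: u + (h *: w + z))| < r.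
  move=> sh; rewrite distrC addrA addrK.
  rewrite (le_lt_trans (ler_normD _ _))// !normrZ.
  move: hr; rewrite ltr_pdivlMr//; apply: le_lt_trans.
  rewrite /n !mulrDr mulr1 -addrA lerD ?ler_wpM2r//.
  by rewrite lerDl.
have [|s sh E] := @MVT_between (fun s => f (s *: u + (h *: w + z)))
    (fun s => 'D_u f (s *: u + (h *: w + z))) h.
  move=> s sh; apply/is_derive_lineP/derivableP/Dr.
  by rewrite /ball_/= (lt_le_trans (close s sh))// ge_min lexx.
have H1 : `|'D_u f z - 'D_u f (s *: u + (h *: w + z))| < e / 2.
  by apply: Hr1; rewrite /ball_/= (lt_le_trans (close s sh))// ge_min lexx orbT.
have H2 : `|dw - h^-1 *: ((f \o shift z) (h *: w) - f z)| < e / 2 by near: h.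
have -> : q h = 'D_u f (s *: u + (h *: w + z)) + h^-1 *: ((f \o shift z) (h *: w) - f z).
  rewrite /q /= [h *: (u + w)]scalerDr -addrA -(subrKA (f (h *: w + z))) scalerDr; congr (_ + _).
  move: E; rewrite scale0r add0r => ->.
  by rewrite /GRing.scale/= mulrC mulfK.
by rewrite opprD addrACA (le_lt_trans (ler_normD _ _))//; lra.
Unshelve. all: by end_near. Qed.

End DirectionalDerivatives.

Section SmoothFunctions.
Context {R : realType} {N : nat}.
Implicit Types (A : set 'rV[R]_N) (f phi : 'rV[R]_N -> R) (z v : 'rV[R]_N).

(** The vector is built up one coordinate at a time with [is_derive_add_dir], which asks for
    continuity of the derivative only in the direction being added. *)
Lemma C1_on_derive A f z v : open A -> C1_on A f -> A z ->
  is_derive z v f (dotp (grad f z) v).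
Proof.
move=> oA [_ C1] Az; rewrite {1}[v]row_sum_delta /dotp.
elim/big_rec2 : _ => [|i w d _ H]; first exact: is_derive0.
rewrite mxE mulrC.
have Dv y : A y -> is_derive y (v 0 i *: delta_mx 0 i) f (v 0 i * partial i f y).
  by move=> Ay; apply: is_derive_scale_dir; apply/derivableP; case: (C1 i) => + _; apply.
have DE y : A y -> 'D_(v 0 i *: delta_mx 0 i) f y = v 0 i * partial i f y.
  by move=> Ay; case: (Dv y Ay).
rewrite -DE//; apply: is_derive_add_dir => //.
  near=> y; have Ay : A y by near: y; exact: open_nbhs_nbhs.
  by case: (Dv y Ay).
have cp : {for z, continuous (partial i f)}.
  case: (C1 i) => _; rewrite continuous_open_subspace// => cp.
  by apply: cp; rewrite inE.
have : (fun y => v 0 i * partial i f y) y @[y --> z] --> v 0 i * partial i f z.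
  exact: (cvgM (cvg_cst _) cp).
move=> cc; suff: 'D_(v 0 i *: delta_mx 0 i) f y @[y --> z] -->
    'D_(v 0 i *: delta_mx 0 i) f z by [].
have nE : \forall y \near z, v 0 i * partial i f y = 'D_(v 0 i *: delta_mx 0 i) f y.
  by near=> y; rewrite DE//; near: y; exact: open_nbhs_nbhs.
by rewrite DE//; apply: cvg_trans cc; exact: (near_eq_cvg nE).
Unshelve. all: by end_near. Qed.

Lemma C2_on_derive2 A phi z v : open A -> C2_on A phi -> A z ->
  (\forall t \near (0 : R), is_derive (t : R) 1 (fun s : R => phi (s *: v + z))
     (dotp (grad phi (t *: v + z)) v)) /\
  is_derive (0 : R) 1 (fun t : R => dotp (grad phi (t *: v + z)) v)
    (dotp (v *m hess phi z) v).
Proof.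
move=> oA [C1phi C2phi] Az; split.
  have [r r0 Hr] := open_ray v oA Az.
  apply/nbhs_normP; exists r => //= t; rewrite /ball_/= sub0r normrN => tr.
  apply/(is_derive_lineP phi z v t); apply: (@C1_on_derive A phi (t *: v + z) v oA C1phi).
  by rewrite addrC; exact: Hr.
have -> : (fun t : R => dotp (grad phi (t *: v + z)) v) =
    \sum_(i < N) (fun t : R => partial i phi (t *: v + z) * v 0 i).
  by apply/funext => t; rewrite fct_sumE; apply: eq_bigr => i _; rewrite mxE.
have -> : dotp (v *m hess phi z) v = \sum_(i < N) (dotp (grad (partial i phi) z) v * v 0 i).
  rewrite /dotp; apply: eq_bigr => j _; congr (_ * _).
  by rewrite mxE; apply: eq_bigr => i _; rewrite !mxE mulrC.
apply: is_derive_sum => i.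
have H : is_derive (0 : R) 1 (fun t : R => partial i phi (t *: v + z))
    (dotp (grad (partial i phi) z) v).
  apply/(is_derive_lineP (partial i phi) z v 0); rewrite scale0r add0r.
  exact: (C1_on_derive v oA (C2phi i) Az).
have := is_deriveM H (is_derive_cst (v 0 i) (0 : R) 1).
by move=> H'; apply: is_derive_eq H' _; rewrite /GRing.scale/= mulr0 add0r mulrC.
Qed.


Lemma continuous_sum (T : topologicalType) (F : 'I_N -> T -> R) (z : T) :
  (forall i, {for z, continuous (F i)}) ->
  {for z, continuous (fun x => \sum_(i < N) F i x)}.
Proof.
move=> cF; have -> : (fun x => \sum_(i < N) F i x) = \sum_(i < N) F i.
  by apply/funext => x; rewrite fct_sumE.
by elim/big_ind : _ => [|f g cf cg|i _]; [exact: cvg_cst|exact: cvgD|exact: cF].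
Qed.

Definition poly_quad (p : {poly R}) (q z0 : 'rV[R]_N) (eps : R) (x : 'rV[R]_N) : R :=
  p.[dotp q (x - z0) + eps * dotp (x - z0) (x - z0)].

Lemma is_derive_poly_quad p q z0 eps z v :
  is_derive z v (poly_quad p q z0 eps)
    (poly_quad p^`() q z0 eps z * (dotp q v + 2 * eps * dotp (z - z0) v)).
Proof.
suff : is_derive (0 : R) 1 (fun t : R => poly_quad p q z0 eps (t *: v + z))
    (poly_quad p^`() q z0 eps z * (dotp q v + 2 * eps * dotp (z - z0) v)).
  by move=> /(is_derive_lineP _ z v 0); rewrite scale0r add0r.
pose r : {poly R} := (dotp q (z - z0) + eps * dotp (z - z0) (z - z0))%:P +
  (dotp q v + 2 * eps * dotp (z - z0) v) *: 'X + (eps * dotp v v) *: 'X^2.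
have rE t : r.[t] = dotp q (t *: v + z - z0) +
    eps * dotp (t *: v + z - z0) (t *: v + z - z0).
  rewrite /r !hornerE /= -[t *: v + z - z0]addrA; move: (z - z0) => w.
  rewrite !dotpDr [dotp (_ + w) (_ *: _)]dotpC [dotp (_ + w) w]dotpC !dotpDr !dotpZr.
  by rewrite !dotpZl [dotp v w]dotpC; ring.
have -> : (fun t : R => poly_quad p q z0 eps (t *: v + z)) = horner p \o horner r.
  by apply/funext => t; rewrite /= rE.
apply: is_derive_eq (is_derive1_comp (is_derive_poly _ _) (is_derive_poly _ _)) _.
rewrite rE scale0r add0r; congr (_ * _).
by rewrite /r !(derivD, derivZ, derivC, derivX, derivXn) !hornerE /=; ring.
Qed.

Lemma continuous_poly_quad p q z0 eps : continuous (poly_quad p q z0 eps).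
Proof.
move=> z.
have cc i : {for z, continuous (fun x : 'rV[R]_N => (x - z0) 0 i)}.
  have -> : (fun x : 'rV[R]_N => (x - z0) 0 i) = (fun x => x 0 i - z0 0 i).
    by apply/funext => x; rewrite !mxE.
  exact: (cvgB (@coord_continuous _ _ _ _ _ _) (cvg_cst _)).
have Qc : {for z, continuous (fun x : 'rV[R]_N =>
    dotp q (x - z0) + eps * dotp (x - z0) (x - z0))}.
  have c1 : {for z, continuous (fun x : 'rV[R]_N => dotp q (x - z0))}.
    by apply: continuous_sum => i; exact: (cvgM (cvg_cst _) (cc i)).
  have c2 : {for z, continuous (fun x : 'rV[R]_N => dotp (x - z0) (x - z0))}.
    by apply: continuous_sum => i; exact: (cvgM (cc i) (cc i)).
  exact: (cvgD c1 (cvgM (cvg_cst _) c2)).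
exact: (continuous_comp Qc (@continuous_horner _ p _)).
Qed.

Lemma partial_poly_quad p q z0 eps i :
  partial i (poly_quad p q z0 eps) =
  (fun z => poly_quad p^`() q z0 eps z * (q 0 i + 2 * eps * (z - z0) 0 i)).
Proof.
apply/funext => z; rewrite /partial.
have [_ ->] := is_derive_poly_quad p q z0 eps z (delta_mx 0 i).
by rewrite !dotp_delta.
Qed.


Lemma is_derive_partial_poly_quad p q z0 eps i j z :
  is_derive z (delta_mx 0 j) (partial i (poly_quad p q z0 eps))
    (poly_quad p^`()^`() q z0 eps z * (q 0 j + 2 * eps * (z - z0) 0 j) *
       (q 0 i + 2 * eps * (z - z0) 0 i) +
     poly_quad p^`() q z0 eps z * (2 * eps * (i == j)%:R)).
Proof.
rewrite partial_poly_quad.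
have Dl : is_derive z (delta_mx 0 j : 'rV[R]_N)
    (fun y : 'rV[R]_N => q 0 i + 2 * eps * (y - z0) 0 i) (2 * eps * (i == j)%:R).
  suff : is_derive (0 : R) 1 (fun t : R => q 0 i + 2 * eps *
      (t *: (delta_mx 0 j : 'rV[R]_N) + z - z0) 0 i) (2 * eps * (i == j)%:R).
    by move=> /(is_derive_lineP (fun y : 'rV[R]_N => q 0 i + 2 * eps * (y - z0) 0 i)
      z (delta_mx 0 j) 0); rewrite scale0r add0r.
  have -> : (fun t : R => q 0 i + 2 * eps *
      (t *: (delta_mx 0 j : 'rV[R]_N) + z - z0) 0 i) =
      horner ((q 0 i + 2 * eps * (z 0 i - z0 0 i))%:P + (2 * eps * (i == j)%:R) *: 'X).
    by apply/funext => t; rewrite !hornerE !mxE eqxx /=; ring.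
  apply: is_derive_eq (is_derive_poly _ _) _.
  by rewrite !(derivD, derivZ, derivC, derivX) !hornerE.
have := is_deriveM (is_derive_poly_quad p^`() q z0 eps z (delta_mx 0 j)) Dl.
move=> H; apply: is_derive_eq H _; rewrite /GRing.scale/= !dotp_delta; ring.
Qed.

Lemma continuous_affine_coord (q z0 : 'rV[R]_N) (c : R) i :
  continuous (fun z : 'rV[R]_N => q 0 i + c * (z - z0) 0 i).
Proof.
move=> z; have -> : (fun z : 'rV[R]_N => q 0 i + c * (z - z0) 0 i) =
    (fun z => q 0 i + c * (z 0 i - z0 0 i)) by apply/funext => x; rewrite !mxE.
exact: (cvgD (cvg_cst _) (cvgM (cvg_cst _) (cvgB (@coord_continuous _ _ _ _ _ _) (cvg_cst _)))).
Qed.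

Lemma C2_on_poly_quad A p q z0 eps : C2_on A (poly_quad p q z0 eps).
Proof.
have cpart i : continuous (partial i (poly_quad p q z0 eps)).
  rewrite partial_poly_quad => z.
  exact: (cvgM (@continuous_poly_quad _ _ _ _ _) (@continuous_affine_coord _ _ _ _ _)).
split.
  split=> [|i]; first exact/continuous_subspaceT/continuous_poly_quad.
  split=> [z _|]; first by case: (is_derive_poly_quad p q z0 eps z (delta_mx 0 i)).
  exact/continuous_subspaceT/cpart.
move=> i; split=> [|j]; first exact/continuous_subspaceT/cpart.
split=> [z _|]; first by case: (is_derive_partial_poly_quad p q z0 eps i j z).
apply/continuous_subspaceT.
have -> : partial j (partial i (poly_quad p q z0 eps)) = fun z =>
    poly_quad p^`()^`() q z0 eps z * (q 0 j + 2 * eps * (z - z0) 0 j) *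
       (q 0 i + 2 * eps * (z - z0) 0 i) +
     poly_quad p^`() q z0 eps z * (2 * eps * (i == j)%:R).
  by apply/funext => z; rewrite {1}/partial; case: (is_derive_partial_poly_quad p q z0 eps i j z).
move=> z.
exact: (cvgD (cvgM (cvgM (@continuous_poly_quad _ _ _ _ _)
  (@continuous_affine_coord _ _ _ _ _)) (@continuous_affine_coord _ _ _ _ _))
  (cvgM (@continuous_poly_quad _ _ _ _ _) (cvg_cst _))).
Qed.

Lemma grad_poly_quad p q z0 eps : grad (poly_quad p q z0 eps) z0 = p^`().[0] *: q.
Proof.
apply/rowP => i; rewrite !mxE partial_poly_quad /poly_quad.
by rewrite subrr dotp0r dotp0r !mxE !mulr0 !addr0.
Qed.

Lemma hess_poly_quad p q z0 eps v :
  dotp (v *m hess (poly_quad p q z0 eps) z0) v =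
  p^`()^`().[0] * dotp q v ^+ 2 + 2 * eps * p^`().[0] * dotp v v.
Proof.
have hE i j : hess (poly_quad p q z0 eps) z0 i j =
    p^`()^`().[0] * (q 0 i * q 0 j) + 2 * eps * p^`().[0] * (j == i)%:R.
  rewrite mxE {1}/partial; case: (is_derive_partial_poly_quad p q z0 eps j i z0) => _ ->.
  by rewrite /poly_quad subrr !dotp0r !mxE !(mulr0, addr0); ring.
rewrite /dotp expr2 big_distrl/= big_distrr/= big_distrr/= -big_split/=.
apply: eq_bigr => j _; rewrite mxE.
rewrite (eq_bigr (fun i => p^`()^`().[0] * q 0 j * (q 0 i * v 0 i) +
    2 * eps * p^`().[0] * ((j == i)%:R * v 0 i))); last first.
  by move=> i _; rewrite hE; ring.
rewrite big_split/= -!big_distrr/= [X in _ + _ * X](bigD1 j)//=.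
rewrite [X in _ + _ * (_ + X)]big1 => [|i ij]; last by rewrite eq_sym (negbTE ij) mul0r.
by rewrite eqxx addr0 mul1r; ring.
Qed.

End SmoothFunctions.

(** * The envelope *)

Section ConvexContinuity.
Context {R : realType} {N : nat}.
Implicit Types (O : set 'rV[R]_N) (F : 'rV[R]_N -> R) (x y z b : 'rV[R]_N).

(** With [h = y - z], the point [y] lies between [z] and [z + s^-1 *: h], and [z] lies between [y]
    and [z - s^-1 *: h], both outer points being at distance [k] from [z]. The two convexity
    inequalities give [|F y - F z| <= s * (M - m)]. *)
Lemma convex_bounded_continuous O F (m M : R) z : open O -> convex_on O F ->
  (forall x, O x -> m <= F x <= M) -> O z ->
  forall e : R, 0 < e -> exists2 d : R, 0 < d & forall y, `|y - z| < d -> `|F y - F z| < e.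
Proof.
move=> oO cF FmM Oz e e0.
have /nbhs_normP[r r0 Hr] := open_nbhs_nbhs (conj oO Oz).
have mM : 0 <= M - m by have := FmM z Oz; lra.
have mM1 : 0 < M - m + 1 by rewrite ltr_wpDl.
pose k := r / 2; have k0 : 0 < k by rewrite divr_gt0.
pose d := Num.min k (k * (e / (M - m + 1))).
have d0 : 0 < d by rewrite lt_min k0 mulr_gt0// divr_gt0.
exists d => // y; rewrite lt_min => /andP[yk ye].
have [->|yz] := eqVneq y z; first by rewrite subrr normr0.
pose h := y - z; pose s := `|h| / k.
have h0 : 0 < `|h| by rewrite normr_gt0 subr_eq0.
have s0 : 0 < s by rewrite divr_gt0.
have s1 : s < 1 by rewrite ltr_pdivrMr// mul1r.
have Ok (w : 'rV[R]_N) : `|w| = k -> O (z + w).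
  by move=> wk; apply: Hr; rewrite /ball_/= opprD addNKr normrN wk /k gtr_pMr// invf_lt1// ltr1n.
have nk : `|s^-1 *: h| = k.
  by rewrite normrZ ger0_norm ?invr_ge0 ?(ltW s0)// /s invf_div divfK// gt_eqF.
have O1 := Ok _ nk; have O2 : O (z - s^-1 *: h) by apply: Ok; rewrite normrN.
have Oy : O y.
  apply: Hr; rewrite /ball_/= distrC (lt_trans yk)// /k ltr_pdivrMr//.
  by rewrite ltr_pMr// ltr1n.
have H1 := cF _ _ O1 Oz s; rewrite s0 s1 in H1.
have E1 : s *: (z + s^-1 *: h) + (1 - s) *: z = y.
  by apply/rowP => i; rewrite !mxE; field; rewrite gt_eqF.
have H2 := cF _ _ Oy O2 (1 + s)^-1.
have s2 : 0 < 1 + s by rewrite addr_gt0.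
rewrite invr_gt0 s2 invf_lt1// ltrDl s0 in H2.
have E2 : (1 + s)^-1 *: y + (1 - (1 + s)^-1) *: (z - s^-1 *: h) = z.
  by apply/rowP => i; rewrite !mxE; field; rewrite !gt_eqF.
rewrite {}E1 in H1; rewrite {}E2 in H2.
have {H1}H1 := H1 isT; have {H2} := H2 isT.
rewrite -(ler_pM2l s2) mulrDr mulrA mulfV ?gt_eqF// mul1r mulrA.
have -> : (1 + s) * (1 - (1 + s)^-1) = s by field; rewrite gt_eqF.
have /andP[m1 M1] := FmM _ O1; have /andP[m2 M2] := FmM _ O2; have /andP[mz Mz] := FmM _ Oz.
move: m1 M1 m2 M2 H1; set F1 := F (_ + _); set F2 := F (_ - _) => m1 M1 m2 M2 H1 H2.
have B : s * (M - m) < e.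
  have : s * (M - m + 1) < e.
    rewrite /s mulrAC ltr_pdivrMr// -ltr_pdivlMr//.
    by rewrite [e * k]mulrC -mulrA.
  by rewrite mulrDr mulr1; lra.
rewrite ltr_norml.
have B1 : s * (F1 - F z) <= s * (M - m) by rewrite ler_pM2l//; lra.
have B2 : s * (F2 - F z) <= s * (M - m) by rewrite ler_pM2l//; lra.
lra.
Qed.

End ConvexContinuity.

(** * Comparison with affine functions, boundary values and continuity of the envelope *)

Section Envelope.
Context {R : realType} {N : nat}.
Hypothesis N_gt0 : (0 < N)%N.
Variable alpha : R.
Hypothesis halpha : 0 < alpha <= 1.
Variable Omega : set 'rV[R]_N.
Hypotheses (oO : open Omega) (bO : bounded_set Omega) (sO : strictly_convex Omega).
Hypothesis O0 : Omega !=set0.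
Implicit Types (g u v : 'rV[R]_N -> R) (x y z b : 'rV[R]_N) (c t : R).
Notation D := (linD alpha).
Notation T := (linT alpha).
Notation S := (linS alpha).
Notation kappa := (kap alpha).
Notation cl := (closure Omega).
Notation bd := (boundary Omega).

(** One direction uses existence of the two-point solution, the other its uniqueness. *)
Lemma alpha_convexP u : alpha_convex alpha Omega u <-> convex_on cl (T \o u).
Proof.
split=> [cu x y cx cy t t01|cu x y cx cy v sv t t01].
  have [v sv Tv] := two_point_solution halpha (u y) (u x).
  have := cu x y cx cy v sv t t01; rewrite -(linT_le alpha) Tv//.
  by case/andP: t01 => /ltW -> /ltW ->.
rewrite -(linT_le alpha) (two_point_unique halpha sv); first exact: cu.
by case/andP: t01 => /ltW -> /ltW ->.
Qed.

(** For the converse, the levels [T (u x - e)] and [T (u x + e)] are compared by monotonicity, which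
    avoids the partial inverse [S]. *)
Lemma within_continuous_linT (A : set 'rV[R]_N) u :
  {within A, continuous u} <-> {within A, continuous (T \o u)}.
Proof.
split=> [cu x|cTu].
  exact: cvg_comp (cu x) (@linT_continuous _ alpha (u x)).
apply/within_continuousP => x Ax e e0.
pose d := Num.min (T (u x + e) - T (u x)) (T (u x) - T (u x - e)).
have d0 : 0 < d by rewrite lt_min !subr_gt0 !linT_lt; apply/andP; lra.
have [r r0 Hr] := (within_continuousP _ _).1 cTu x Ax d d0.
exists r => // y Ay yx; have := Hr y Ay yx.
rewrite /= ltr_norml lt_min => /andP[H /andP[H1 _]].
have H2 : - (T (u x) - T (u x - e)) < T (u y) - T (u x).
  by apply: le_lt_trans H; rewrite lerN2 ge_min lexx orbT.
have {}H1 : T (u y) < T (u x + e) by lra.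
have {}H2 : T (u x - e) < T (u y) by lra.
by move: H1 H2; rewrite !linT_lt ltr_norml; lra.
Qed.

Definition affine c b x0 x : R := c + dotp b (x - x0).

Lemma affine_comb c b x0 x y t :
  affine c b x0 (t *: x + (1 - t) *: y) = t * affine c b x0 x + (1 - t) * affine c b x0 y.
Proof. by rewrite /affine !dotpBr dotpDr !dotpZr; ring. Qed.

Lemma affine_continuous c b x0 x (e : R) : 0 < e ->
  exists2 d : R, 0 < d & forall y, `|y - x| < d -> `|affine c b x0 y - affine c b x0 x| < e.
Proof.
move=> e0; have B1 : 0 < dotp_bound b + 1 by rewrite ltr_wpDl// dotp_bound_ge0.
exists (e / (dotp_bound b + 1)) => [|y]; first by rewrite divr_gt0.
rewrite ltr_pdivlMr// => yx.
have -> : affine c b x0 y - affine c b x0 x = dotp b (y - x).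
  by rewrite /affine !dotpBr; ring.
rewrite (le_lt_trans (dotp_le_bound _ _))// (le_lt_trans _ yx)// mulrC.
by rewrite ler_wpM2l// lerDl.
Qed.

Lemma nonzero_vector : exists v : 'rV[R]_N, v != 0.
Proof.
exists (const_mx 1); apply/eqP => /rowP /(_ (Ordinal N_gt0)).
by rewrite !mxE; apply/eqP/oner_neq0.
Qed.

Lemma boundary_nonempty : bd !=set0.
Proof.
have [z Oz] := O0; have [v v0] := nonzero_vector.
by have [s _ bs] := ray_boundary oO bO Oz v0; exists (z + s *: v).
Qed.

(** A maximum principle: an interior point lies on a chord with both ends on the boundary. *)
Lemma convex_le_affine v c b x0 : convex_on cl (T \o v) ->
  (forall x, bd x -> T (v x) <= affine c b x0 x) ->
  forall z, cl z -> T (v z) <= affine c b x0 z.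
Proof.
move=> cv vA z cz; have [Oz|] := closure_case oO cz; last exact: vA.
have [w w0] := nonzero_vector.
have [x [y [t [bx by_ t01 ->]]]] := boundary_chord oO bO Oz w0.
have [cx _] := (boundaryE oO _).1 bx; have [cy _] := (boundaryE oO _).1 by_.
rewrite affine_comb (le_trans (cv x y cx cy t t01))//.
case/andP: t01 => t0 t1.
by rewrite lerD// ler_wpM2l ?vA ?subr_ge0// ltW.
Qed.

Variable g : 'rV[R]_N -> R.
Hypothesis gcont : {within bd, continuous g}.

Definition admissible v := alpha_convex alpha Omega v /\ forall x, bd x -> v x <= g x.

Notation env := (envelope alpha Omega g).

Lemma datum_bounded : exists m M : R, forall x, bd x -> m <= g x <= M.
Proof.
have cb := boundary_compact bO.
have [xm _ Hm] := compact_EVT_min boundary_nonempty cb gcont.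
have [xM _ HM] := compact_EVT_max boundary_nonempty cb gcont.
by exists (g xm), (g xM) => x bx; rewrite Hm ?HM ?inE.
Qed.

Lemma admissible_cst m : (forall x, bd x -> m <= g x) -> admissible (fun=> m).
Proof.
move=> mg; split=> //; apply/alpha_convexP => x y _ _ t _ /=.
by rewrite -mulrDl addrC subrK mul1r.
Qed.

Lemma admissible_le M v z : (forall x, bd x -> g x <= M) -> admissible v -> cl z -> v z <= M.
Proof.
move=> gM [/alpha_convexP cv vg] cz; rewrite -(linT_le alpha).
have := @convex_le_affine v (T M) 0 0 cv; rewrite /affine => /(_ _ z cz).
rewrite dotpC dotp0r addr0; apply=> x bx.
by rewrite dotpC dotp0r addr0 linT_le (le_trans (vg x bx))// gM.
Qed.

Lemma admissible_le_env v z : admissible v -> cl z -> v z <= env z.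
Proof.
move=> av cz; have [m [M mM]] := datum_bounded.
(* A real [sup] is an upper bound only for a set bounded above; the constant [M] bounds all
   competitors. *)
apply: ub_le_sup; last by exists v.
exists M => _ [w aw <-]; apply: admissible_le => // x /mM/andP[]//.
Qed.

Lemma env_le z c : cl z -> (forall v, admissible v -> v z <= c) -> env z <= c.
Proof.
move=> cz vc; have [m [M mM]] := datum_bounded.
apply: ge_sup; last by move=> _ [w aw <-]; exact: vc.
by exists m, (fun=> m) => //; apply: admissible_cst => x /mM/andP[].
Qed.

Lemma env_bounded : exists m M : R, (forall x, bd x -> m <= g x <= M) /\
  forall z, cl z -> m <= env z <= M.
Proof.
have [m [M mM]] := datum_bounded; exists m, M; split=> // z cz; apply/andP; split.
  by apply: (admissible_le_env (v := fun=> m)) => //; apply: admissible_cst => x /mM/andP[].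
apply: env_le => // v av; apply: admissible_le => // x /mM/andP[]//.
Qed.

Lemma env_convex : convex_on cl (T \o env).
Proof.
have [m [M [_ envm]]] := env_bounded.
move=> x y cx cy t /[dup] t01 /andP[t0 t1] /=.
set c := _ + _ * T (env y).
(* This puts [c] in the range of [T], so that the claim becomes [env _ <= S c] and can be checked on
   each competitor. *)
have Tmc : T m <= c.
  have -> : T m = t * T m + (1 - t) * T m by ring.
  have /andP[mx _] := envm x cx; have /andP[my _] := envm y cy.
  by rewrite /c lerD// ler_wpM2l ?linT_le ?subr_ge0// ltW.
rewrite -(linSK halpha Tmc) linT_le; apply: env_le.
  exact: (convex_dom_closure sO).
move=> v [/alpha_convexP cv vg]; rewrite -(linT_le alpha) (linSK halpha Tmc).
rewrite (le_trans (cv x y cx cy t t01))// /c lerD// ler_wpM2l ?subr_ge0 ?(ltW t0) ?(ltW t1)//.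
  by rewrite linT_le admissible_le_env//; split=> //; apply/alpha_convexP.
by rewrite linT_le admissible_le_env//; split=> //; apply/alpha_convexP.
Qed.

Lemma env_le_datum x : bd x -> env x <= g x.
Proof.
move=> bx; apply: env_le; first by case/(boundaryE oO): bx.
by move=> v [_]; apply.
Qed.

(** The affine function may leave the range of [T]. Its maximum with [T m], for a lower bound [m] of
    [g], is still convex and below [T \o g], and [S] of that maximum is a competitor. *)
Lemma env_ge_affine c b x0 : (forall x, bd x -> affine c b x0 x <= T (g x)) ->
  forall z, cl z -> affine c b x0 z <= T (env z).
Proof.
move=> Ag z cz; have [m [M mM]] := datum_bounded.
pose v z := S (Num.max (T m) (affine c b x0 z)).
have Tv x : T (v x) = Num.max (T m) (affine c b x0 x).
  by apply: (linSK halpha (a := m)); rewrite le_max lexx.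
have av : admissible v.
  split.
    apply/alpha_convexP => x y cx cy t /andP[t0 t1] /=.
    rewrite !Tv affine_comb ge_max; apply/andP; split.
      rewrite [leLHS](_ : _ = t * T m + (1 - t) * T m); last by ring.
      by rewrite lerD// ler_wpM2l ?subr_ge0 ?(ltW t0) ?(ltW t1)// le_max lexx.
    by rewrite lerD// ler_wpM2l ?subr_ge0 ?(ltW t0) ?(ltW t1)// le_max lexx orbT.
  move=> x bx; rewrite -(linT_le alpha) Tv ge_max linT_le Ag// andbT.
  by case/andP: (mM x bx).
by rewrite (@le_trans _ _ (T (v z)))// ?linT_le ?admissible_le_env// Tv le_max lexx orbT.
Qed.

Lemma env_le_affine c b x0 : (forall x, bd x -> T (g x) <= affine c b x0 x) ->
  forall z, cl z -> T (env z) <= affine c b x0 z.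
Proof.
move=> Ag; apply: convex_le_affine env_convex _ => x bx.
by rewrite (le_trans _ (Ag x bx))// linT_le env_le_datum.
Qed.

(** The barrier for [T \o g] is a pair of affine functions with slopes [b] and [- b] enclosing the
    data, and both comparisons pass to the envelope. *)
Lemma env_boundary_barrier x0 (e : R) : bd x0 -> 0 < e ->
  exists b, forall x, cl x -> `|T (env x) - T (g x0)| <= e - dotp b (x - x0).
Proof.
move=> bx0 e0; have cTg := (within_continuous_linT _ _).1 gcont.
have [b Hb] := boundary_barrier oO bO sO O0 cTg bx0 e0.
exists b => x cx.
have H1 := @env_ge_affine (T (g x0) - e) b x0 _ x cx.
have H2 := @env_le_affine (T (g x0) + e) (- b) x0 _ x cx.
have Nb y : dotp (- b) y = - dotp b y by rewrite dotpC dotpNr dotpC.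
have {}H1 : affine (T (g x0) - e) b x0 x <= T (env x).
  by apply: H1 => y /Hb; rewrite /affine ler_norml/=; lra.
have {}H2 : T (env x) <= affine (T (g x0) + e) (- b) x0 x.
  by apply: H2 => y /Hb; rewrite /affine Nb ler_norml/=; lra.
by move: H1 H2; rewrite /affine Nb ler_norml; lra.
Qed.

Lemma env_boundary x0 : bd x0 -> env x0 = g x0.
Proof.
move=> bx0; have [cx0 _] := (boundaryE oO _).1 bx0.
have /eqP : T (env x0) - T (g x0) = 0.
  apply/eqP; rewrite -normr_le0; apply/ler_addgt0Pl => e e0.
  have [b Hb] := env_boundary_barrier bx0 e0.
  by have := Hb x0 cx0; rewrite subrr dotp0r; lra.
by rewrite subr_eq0 => /eqP /(can_inj (linTK alpha)).
Qed.

Lemma env_continuous : {within cl, continuous env}.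
Proof.
apply/within_continuous_linT/within_continuousP => x cx e e0.
have [Ox|bx] := closure_case oO cx.
  have [m [M [_ mM]]] := env_bounded.
  have cvx : convex_on Omega (T \o env).
    by move=> y z Oy Oz; apply: env_convex; exact: domain_closure.
  have [|d d0 Hd] := @convex_bounded_continuous R N Omega (T \o env) (T m) (T M) x oO cvx _ Ox e e0.
    by move=> y Oy; rewrite /= !linT_le; apply/mM/domain_closure.
  by exists d => // y _; exact: Hd.
have e2 : 0 < e / 2 by rewrite divr_gt0.
have [b Hb] := env_boundary_barrier bx e2.
have [d d0 Hd] := @affine_continuous 0 b x x _ e2.
exists d => // y cy yx; rewrite /= (env_boundary bx).
have := Hd y yx; have := Hb y cy.
rewrite /affine subrr dotp0r !add0r subr0 ltr_norml => H1 H2.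
by rewrite (le_lt_trans H1)//; lra.
Qed.

End Envelope.

(** * The envelope is a viscosity solution *)

Section Semicontinuity.
Context {R : realType} {V : normedModType R}.
Implicit Types (A : set V) (u : V -> R).

Lemma within_continuous_usc A u : {within A, continuous u} ->
  upper_semicontinuous (fun z : subspace A => (u z)%:E).
Proof.
move=> cu x a; rewrite lte_fin => ua.
exists (u @^-1` [set r | r < a]); last by move=> y /=; rewrite lte_fin.
by apply: (cu x); apply: open_nbhs_nbhs; split=> //; exact: open_lt.
Qed.

Lemma within_continuous_lsc A u : {within A, continuous u} ->
  lower_semicontinuous (fun z : subspace A => (u z)%:E).
Proof.
move=> cu x a; rewrite lte_fin => ua.
exists (u @^-1` [set r | a < r]); last by move=> y /=; rewrite lte_fin.
by apply: (cu x); apply: open_nbhs_nbhs; split=> //; exact: open_gt.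
Qed.

End Semicontinuity.

(** * Bounds for the infimum over unit vectors *)

Section Hamiltonian.
Context {R : realType} {N : nat}.
Hypothesis N_gt0 : (0 < N)%N.
Variable alpha : R.
Hypothesis halpha : 0 < alpha <= 1.
Implicit Types (f : 'rV[R]_N -> R) (z v : 'rV[R]_N) (c : R).

Definition ham f z v : R :=
  alpha * dotp (v *m hess f z) v + (1 - alpha) * dotp (grad f z) v ^+ 2.

Lemma calLE f z : calL alpha f z = inf [set ham f z v | v in [set v | enorm v = 1]].
Proof.
by rewrite /calL /ham; congr inf; apply/seteqP; split=> [_ [v v1 <-]|_ [v v1 <-]];
  exists v => //; rewrite real_normK ?num_real.
Qed.

Lemma le_calL f z c : (forall v, enorm v = 1 -> c <= ham f z v) -> c <= calL alpha f z.
Proof.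
move=> cH; rewrite calLE; apply: lb_le_inf => [|_ [v /= v1 <-]]; last exact: cH.
(* A lower bound passes to [inf] only if the set is nonempty; [N > 0] supplies a unit vector. *)
pose d : 'rV[R]_N := delta_mx 0 (Ordinal N_gt0).
have d0 : d != 0.
  by apply/eqP => /rowP /(_ (Ordinal N_gt0)); rewrite !mxE !eqxx; apply/eqP/oner_neq0.
exists (ham f z ((enorm d)^-1 *: d)), ((enorm d)^-1 *: d) => //.
exact: enorm_normalize.
Qed.

Lemma hamZ f z v c : ham f z (c *: v) = c ^+ 2 * ham f z v.
Proof. by rewrite /ham -scalemxAl dotpZl !dotpZr; ring. Qed.

Lemma calL_le0 f z v : v != 0 -> ham f z v <= 0 -> calL alpha f z <= 0.
Proof.
move=> v0 Hv; rewrite calLE.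
(* The sum of the absolute values of the Hessian entries; it bounds the Hamiltonian from below on
   unit vectors, as needed for [inf] to lie below its elements. *)
pose B := \sum_j dotp_bound (\row_i hess f z i j).
apply: (@le_trans _ _ (ham f z ((enorm v)^-1 *: v))); last first.
  by rewrite hamZ mulr_ge0_le0// sqr_ge0.
apply: (@inf_leP _ _ (- (alpha * B))); last first.
  by exists ((enorm v)^-1 *: v) => //; exact: enorm_normalize.
have /andP[a0 a1] := halpha.
move=> _ [w /= w1 <-]; rewrite /ham -[leLHS]addr0 -mulrN lerD//; last first.
  by rewrite mulr_ge0 ?sqr_ge0// subr_ge0.
rewrite ler_pM2l// lerNl (le_trans (ler_norm _))// normrN.
rewrite (le_trans (ler_norm_sum _ _ _))//; apply: ler_sum => j _.
have -> : (w *m hess f z) 0 j = dotp (\row_i hess f z i j) w.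
  by rewrite mxE; apply: eq_bigr => i _; rewrite !mxE mulrC.
by rewrite normrM -[leRHS]mulr1 ler_pM ?dotp_enorm1 ?enorm1_coord.
Qed.

End Hamiltonian.

Section EnvelopeSolution.
Context {R : realType} {N : nat}.
Hypothesis N_gt0 : (0 < N)%N.
Variable alpha : R.
Hypothesis halpha : 0 < alpha <= 1.
Variable Omega : set 'rV[R]_N.
Hypotheses (oO : open Omega) (bO : bounded_set Omega) (sO : strictly_convex Omega).
Hypothesis O0 : Omega !=set0.
Implicit Types (u : 'rV[R]_N -> R) (x y z v b : 'rV[R]_N) (c t : R).
Notation D := (linD alpha).
Notation T := (linT alpha).
Notation kappa := (kap alpha).
Notation cl := (closure Omega).
Notation bd := (boundary Omega).

Lemma alpha_gt0 : 0 < alpha.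
Proof. by case/andP: halpha. Qed.

(** If [Lalpha alpha phi t0 < 0], then [T \o phi] has negative second derivative at [t0] and lies
    strictly below its tangent on both sides. Averaging over [t0 - h] and [t0 + h] contradicts
    convexity of [T \o u] at the midpoint [z]. *)
Lemma alpha_convex_subsolution u : {within Omega, continuous u} ->
  alpha_convex alpha Omega u -> viscosity_subsolution alpha Omega u.
Proof.
move=> cu /(alpha_convexP halpha) cTu; split; first exact: within_continuous_usc.
move=> z x y t0 Oz Ox Oy /andP[t00 t01] zE phi [_ [d1 _] [d2 _]] phi0 uphi.
rewrite leNgt; apply/negP => L0.
have Dphi t : is_derive t 1 phi (derive1 phi t).
  by rewrite derive1E; apply/derivableP/d1.
have Dphi1 t : is_derive t 1 (derive1 phi) (derive1 (derive1 phi) t).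
  by rewrite derive1E; apply/derivableP/d2.
pose F1 t := D (phi t) * derive1 phi t.
pose F2 := D (phi t0) * (kappa * derive1 phi t0 ^+ 2 + derive1 (derive1 phi) t0).
have F2_lt0 : F2 < 0.
  rewrite /F2 pmulr_rlt0 ?linD_gt0// -(pmulr_rlt0 _ alpha_gt0) mulrDr mulrA alpha_kap//.
  by move: L0; rewrite /Lalpha real_normK ?num_real// addrC.
pose l t := F1 t0 * t.
have Dl t : is_derive t 1 l (F1 t0).
  by apply: is_derive_eq (is_deriveZ (F1 t0) (is_derive_id t 1)) _; rewrite /GRing.scale/= mulr1.
have [||||r r0 Hr] := @second_order_strict_min R (l - (T \o phi)) (fun t => F1 t0 - F1 t) t0 (- F2).
- near=> t; exact: (is_deriveB (Dl t) (is_derive_linT_comp alpha (Dphi t))).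
- have := is_deriveB (is_derive_cst (F1 t0) t0 1) (is_derive_linT_comp2 alpha (Dphi t0) (Dphi1 t0)).
  by rewrite sub0r.
- by rewrite subrr.
- by rewrite oppr_gt0.
pose h := Num.min r (Num.min t0 (1 - t0)) / 2.
have m0 : 0 < Num.min r (Num.min t0 (1 - t0)) by rewrite !lt_min r0 t00 subr_gt0 t01.
have mr : Num.min r (Num.min t0 (1 - t0)) <= r by rewrite ge_min lexx.
have mt0 : Num.min r (Num.min t0 (1 - t0)) <= t0 by rewrite !ge_min lexx orbT.
have mt1 : Num.min r (Num.min t0 (1 - t0)) <= 1 - t0 by rewrite !ge_min lexx !orbT.
have h0 : 0 < h by rewrite divr_gt0.
have hr : h < r by rewrite /h; lra.
have hp : 0 < t0 + h < 1 by rewrite /h; lra.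
have hm : 0 < t0 - h < 1 by rewrite /h; lra.
have Hp := Hr (t0 + h); have Hm := Hr (t0 - h).
rewrite addrAC subrr add0r normrN ger0_norm ?(ltW h0)// h0 hr in Hm.
rewrite addrAC subrr add0r ger0_norm ?(ltW h0)// h0 hr in Hp.
have {Hp} := Hp isT; have {Hm} := Hm isT; rewrite !fctE /l /= phi0.
have cvx := convex_dom_domain sO.
have := uphi _ hp; rewrite -(linT_le alpha); have := uphi _ hm; rewrite -(linT_le alpha).
set zp := (t0 + h) *: x + _; set zm := (t0 - h) *: x + _ => um up.
have czp : cl zp by apply/domain_closure/cvx.
have czm : cl zm by apply/domain_closure/cvx.
have := cTu zp zm czp czm (2^-1) _.
have -> : 2^-1 *: zp + (1 - 2^-1) *: zm = z.
  by rewrite zE; apply/rowP => i; rewrite !mxE; field.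
by move=> /(_ ltac:(lra)) /=; lra.
Unshelve. all: by end_near. Qed.

Variable g : 'rV[R]_N -> R.
Hypothesis gcont : {within bd, continuous g}.
Notation env := (envelope alpha Omega g).

Lemma affine_within_continuous (A : set 'rV[R]_N) c b x0 :
  {within A, continuous (affine c b x0)}.
Proof.
apply/within_continuousP => x _ e e0.
by have [d d0 Hd] := @affine_continuous _ _ c b x0 x e e0; exists d => // y _; exact: Hd.
Qed.

(* An affine function lying strictly below the data could be raised. *)
Lemma env_contact c b z : Omega z -> T (env z) = c ->
  exists2 x, bd x & T (g x) <= affine c b z x.
Proof.
move=> Oz Ec; apply: contrapT => /forall2NP H.
have gA x : bd x -> affine c b z x < T (g x).
  by move=> bx; have [//|/negP] := H x; rewrite -ltNge.
have cG : {within bd, continuous (fun x => T (g x) - affine c b z x)}.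
  move=> x; apply: cvgB; first exact: ((within_continuous_linT _ _ _).1 gcont x).
  exact: affine_within_continuous.
have [xm xmb Hm] := compact_EVT_min (boundary_nonempty N_gt0 oO bO O0) (boundary_compact bO) cG.
rewrite inE in xmb; set d := T (g xm) - _ in Hm.
have d0 : 0 < d by rewrite subr_gt0 gA.
have := @env_ge_affine R N N_gt0 alpha halpha Omega oO bO O0 g gcont (c + d) b z _ z (domain_closure Oz).
have H1 x : bd x -> affine (c + d) b z x <= T (g x).
  by move=> bx; have := Hm x; rewrite inE => /(_ bx); rewrite /affine; lra.
by move=> /(_ H1); rewrite /affine subrr dotp0r addr0 Ec; lra.
Qed.

Lemma env_supersolution : viscosity_supersolution alpha Omega env.
Proof.
have cenv := env_continuous N_gt0 halpha oO bO sO O0 gcont.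
have cvx := env_convex N_gt0 halpha oO bO sO O0 gcont.
split.
  by apply: within_continuous_lsc; apply: continuous_subspaceW cenv; exact: subset_closure.
move=> z Oz phi C2phi phiz phile; have cz := domain_closure Oz.
(* The gradient of [T \o phi] at [z]. *)
pose b := D (phi z) *: grad phi z.
pose F v t := T (phi (t *: v + z)).
pose F1 v t := D (phi (t *: v + z)) * dotp (grad phi (t *: v + z)) v.
have F10 v : F1 v 0 = dotp b v by rewrite /F1 scale0r add0r dotpZl.
have Fle x t : cl x -> x != z -> 0 < t < 1 ->
    F (x - z) t <= t * T (env x) + (1 - t) * T (env z).
  move=> cx xz t01; have Exz : t *: (x - z) + z = t *: x + (1 - t) *: z.
    by rewrite scalerBr scalerBl scale1r addrAC -addrA.
  rewrite /F Exz (le_trans _ (cvx x z cx cz t t01))//= linT_le.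
  exact/phile/sO.
have DF v : \forall t \near (0 : R), is_derive (t : R) 1 (F v) (F1 v t).
  have [H _] := C2_on_derive2 v oO C2phi Oz.
  by apply: filterS H => t; exact: is_derive_linT_comp.
have DF1 v : is_derive (0 : R) 1 (F1 v) (D (phi z) *
    (kappa * dotp (grad phi z) v ^+ 2 + dotp (v *m hess phi z) v)).
  have [/nbhs_singleton H1 H2] := C2_on_derive2 v oO C2phi Oz.
  by have := is_derive_linT_comp2 alpha H1 H2; rewrite scale0r add0r.
have F0 v : F v 0 = T (env z) by rewrite /F scale0r add0r phiz.
have [x1 bx1 Hx1] := env_contact b Oz erefl.
have [cx1 nx1] := (boundaryE oO _).1 bx1.
have x1z : x1 != z by apply: contra_notN nx1 => /eqP ->.
pose v := x1 - z.
have v0 : v != 0 by rewrite subr_eq0.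
(* It suffices to refute a positive Hamiltonian in the direction [v] of the contact point.
   Positivity would lift [T \o phi] strictly above its tangent along [v], whereas convexity and the
   contact keep the envelope below that tangent. *)
apply: (calL_le0 halpha v0); rewrite leNgt; apply/negP => ham0.
pose l (t : R) := - (dotp b v) * t.
have Dl t : is_derive t 1 l (- dotp b v).
  by apply: is_derive_eq (is_deriveZ (- dotp b v) (is_derive_id t 1)) _; rewrite /GRing.scale/= mulr1.
have [||||r r0 Hr] := @second_order_strict_min R (F v + l) (fun t => F1 v t - dotp b v) 0
  (D (phi z) * (kappa * dotp (grad phi z) v ^+ 2 + dotp (v *m hess phi z) v)).
- by apply: filterS (DF v) => t Ht; apply: is_deriveD.
- have := is_deriveB (DF1 v) (is_derive_cst (dotp b v) (0 : R) 1).
  by rewrite subr0.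
- by rewrite F10 subrr.
- rewrite pmulr_rgt0 ?linD_gt0// -(pmulr_rgt0 _ alpha_gt0) mulrDr mulrA alpha_kap//.
  by move: ham0; rewrite /ham addrC.
pose t := Num.min r 1 / 2.
have m0 : 0 < Num.min r 1 by rewrite lt_min r0 ltr01.
have mr : Num.min r 1 <= r by rewrite ge_min lexx.
have m1 : Num.min r 1 <= 1 by rewrite ge_min lexx orbT.
have t01 : 0 < t < 1 by rewrite /t; lra.
have := Hr t; rewrite subr0 ger0_norm; last by rewrite /t; lra.
move=> /(_ ltac:(rewrite /t; lra)); rewrite !fctE /l mulr0 addr0 F0.
have := Fle x1 t cx1 x1z t01; rewrite -/v.
rewrite (env_boundary N_gt0 halpha oO bO sO O0 gcont bx1).
move: Hx1; rewrite /affine -/v => Hx1 E1 E2.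
case/andP: t01 => t0 t1.
have := ler_wpM2l (ltW t0) Hx1; lra.
Qed.

End EnvelopeSolution.

(** * Uniqueness *)

Section TestPolynomial.
Context {R : realType}.
Implicit Types (c a e k x : R).

(** The shape produced by [linT_upper_test] and [linT_lower_test]; [k] does not enter the
    derivatives at 0 up to order two. *)
Definition test_poly c a e k : {poly R} :=
  c%:P + a *: 'X - e *: 'X^2 + k *: 'X^4.

Lemma horner_test_poly c a e k x :
  (test_poly c a e k).[x] = c + a * x - e * x ^+ 2 + k * x ^+ 4.
Proof. by rewrite /test_poly !hornerE. Qed.

Lemma deriv_test_poly0 c a e k : (test_poly c a e k)^`().[0] = a.
Proof.
rewrite /test_poly !(derivD, derivN, derivZ, derivC, derivX, derivXn) !hornerE /=.
ring.
Qed.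

Lemma deriv2_test_poly0 c a e k : (test_poly c a e k)^`()^`().[0] = - (2 * e).
Proof.
rewrite /test_poly !(derivD, derivN, derivZ, derivC, derivX, derivXn, derivMn).
rewrite !hornerE /=; ring.
Qed.

Lemma C2_line_horner (p : {poly R}) : C2_line setT (horner p) /\
  forall t, derive1 (horner p) t = p^`().[t] /\
    derive1 (derive1 (horner p)) t = p^`()^`().[t].
Proof.
have [C2p E] : C2_line setT (horner p) /\ forall t, setT t ->
    derive1 (horner p) t = p^`().[t] /\ derive1 (derive1 (horner p)) t = p^`()^`().[t].
  apply: (@C2_lineI _ _ _ (horner p^`()) (horner p^`()^`())) => [|t _].
    exact: openT.
  exact: continuous_horner.
by split=> // t; exact: E.
Qed.

End TestPolynomial.

Section Uniqueness.
Context {R : realType} {N : nat}.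
Hypothesis N_gt0 : (0 < N)%N.
Variable alpha : R.
Hypothesis halpha : 0 < alpha <= 1.
Variable Omega : set 'rV[R]_N.
Hypotheses (oO : open Omega) (bO : bounded_set Omega) (sO : strictly_convex Omega).
Hypothesis O0 : Omega !=set0.
Implicit Types (u : 'rV[R]_N -> R) (x y z v b : 'rV[R]_N) (c t : R).
Notation D := (linD alpha).
Notation T := (linT alpha).
Notation kappa := (kap alpha).
Notation cl := (closure Omega).
Notation bd := (boundary Omega).

(** Composing the polynomial of [linT_upper_test] with the parabola [r] gives a test function
    touching [u] from above at the midpoint, and its [Lalpha] there is
    [2 * alpha * (d * q ^+ 2 - a * eps) < 0]. *)
Lemma subsolution_not_concave u x y (q eps : R) : viscosity_subsolution alpha Omega u ->
  Omega x -> Omega y -> 0 < eps ->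
  ~ forall t, 0 < t < 1 -> T (u (t *: x + (1 - t) *: y)) <=
      T (u (2^-1 *: x + (1 - 2^-1) *: y)) + (q * (t - 2^-1) - eps * (t - 2^-1) ^+ 2).
Proof.
move=> [_ su] Ox Oy eps0; set z := 2^-1 *: x + _ => H.
have Oz : Omega z by apply: (convex_dom_domain sO) => //; lra.
set c := u z in H; pose a := (D c)^-1.
have a0 : 0 < a by rewrite invr_gt0 linD_gt0.
(* Chosen for [d * q ^+ 2 < a * eps]; the added 1 covers [q = 0]. *)
pose d := a * eps / (2 * (q ^+ 2 + 1)).
have q1 : 0 < q ^+ 2 + 1 by rewrite ltr_wpDl// sqr_ge0.
have d0 : 0 < d by rewrite divr_gt0 ?mulr_gt0.
have dq : d * q ^+ 2 < a * eps.
  have E : d * (2 * (q ^+ 2 + 1)) = a * eps by rewrite divfK// gt_eqF ?mulr_gt0.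
  have := mulr_ge0 (ltW d0) (sqr_ge0 q); have := mulr_gt0 a0 eps0; lra.
have X0 : 0 <= `|q| + eps by rewrite addr_ge0// ltW.
have [K K0 HK] := linT_upper_test halpha c d0 X0.
set e := _ - d in HK.
pose P := test_poly c a e K.
pose r : {poly R} := q *: ('X - (2^-1)%:P) - eps *: ('X - (2^-1)%:P) ^+ 2.
have rE t : r.[t] = q * (t - 2^-1) - eps * (t - 2^-1) ^+ 2.
  by rewrite /r !hornerE.
have r0 : r.[2^-1] = 0 by rewrite rE subrr expr0n !mulr0 subr0.
have r1 : r^`().[2^-1] = q.
  rewrite /r !(derivD, derivN, derivZ, derivX, derivC, derivXn, deriv_exp) !hornerE /=; ring.
have r2 : r^`()^`().[2^-1] = - (2 * eps).
  rewrite /r !(derivD, derivN, derivZ, derivX, derivC, derivXn, derivMn, derivM, deriv_exp).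
  rewrite !hornerE /=; ring.
have PE w : P.[w] = c + a * w - e * w ^+ 2 + K * w ^+ 4 by exact: horner_test_poly.
have P1 : P^`().[0] = a by exact: deriv_test_poly0.
have P2 : P^`()^`().[0] = - (2 * e) by exact: deriv2_test_poly0.
clearbody P r.
have [C2 E12] := C2_line_horner (P \Po r).
have := su z x y (2^-1) Oz Ox Oy ltac:(lra) erefl (horner (P \Po r)) C2.
have [E1 E2] := E12 2^-1.
rewrite /Lalpha E1 E2 real_normK ?num_real// !deriv_comp derivM deriv_comp.
rewrite !(hornerD, hornerM, horner_comp).
rewrite r0 r1 r2 P1 P2 PE !expr0n/= !mulr0 subr0 !addr0 => /(_ erefl).
case/(_ _)/negP; last first.
  apply/negP; rewrite -ltNge.
  have -> : alpha * (- (2 * e) * q * q + a * - (2 * eps)) + (1 - alpha) * (a * q) ^+ 2 =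
      2 * alpha * (d * q ^+ 2 - a * eps).
    by rewrite /e -(alpha_kap halpha) -exprVn -/a; field.
  by rewrite pmulr_rlt0 ?subr_lt0// mulr_gt0// (alpha_gt0 halpha).
move=> t t01; rewrite horner_comp PE rE -(linT_le alpha).
rewrite (le_trans (H t t01))//; apply: HK.
have t2 : `|t - 2^-1| <= 1 by rewrite ler_norml; lra.
rewrite (le_trans (ler_normB _ _))// [`|q * _|]normrM [`|eps * _|]normrM normrX lerD//.
  by rewrite -[leRHS]mulr1 ler_wpM2l.
by rewrite (gtr0_norm eps0) -[leRHS]mulr1 ler_wpM2l ?(ltW eps0)// exprn_ile1.
Qed.

(** If [T \o u] exceeds its chord somewhere, subtracting the chord and a small concave parabola
    leaves a function with an interior maximum at [s0]. There [T \o u] is touched from above by a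
    strictly concave parabola, against [subsolution_not_concave]. *)
Lemma subsolution_alpha_convex u : {within cl, continuous u} ->
  viscosity_subsolution alpha Omega u -> alpha_convex alpha Omega u.
Proof.
move=> cu su; apply/(alpha_convexP halpha) => x y cx cy t t01 /=.
have [->|xy] := eqVneq x y; first by rewrite convex_comb_same; lra.
rewrite leNgt; apply/negP => lt.
pose G (s : R) := s *: x + (1 - s) *: y.
have cG s : 0 <= s <= 1 -> cl (G s).
  rewrite /G => /andP[]; rewrite le_eqVlt => /predU1P[<- _|s0].
    by rewrite scale0r add0r subr0 scale1r.
  rewrite le_eqVlt => /predU1P[->|s1]; first by rewrite scale1r subrr scale0r addr0.
  by apply: (convex_dom_closure sO) => //; apply/andP.
pose l s := s * T (u x) + (1 - s) * T (u y).
pose eta := T (u (G t)) - l t.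
have eta0 : 0 < eta by rewrite subr_gt0.
(* The correction vanishes at both ends and is less than [eta] at [t], so [h] is zero at the ends
   and positive at [t]. *)
pose h s := T (u (G s)) - l s - eta * (s * (1 - s)).
have ch : {within `[0, 1], continuous h}.
  have cTu := (within_continuous_linT alpha _ _).1 cu.
  have cTG : {within `[0, 1], continuous (fun s => T (u (G s)))}.
    apply/within_continuousP => s; rewrite /= in_itv/= => s01 e e0.
    have [d d0 Hd] := (within_continuousP _ _).1 cTu (G s) (cG s s01) e e0.
    have xy0 : 0 < `|x - y| by rewrite normr_gt0 subr_eq0.
    exists (d / `|x - y|) => [|s']; first by rewrite divr_gt0.
    rewrite /= in_itv/= => s'01 ss'; apply: Hd; first exact: cG.
    have -> : G s' - G s = (s' - s) *: (x - y).
      by apply/rowP => i; rewrite !mxE; ring.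
    by rewrite normrZ -ltr_pdivlMr.
  have cp : continuous (fun s : R => l s + eta * (s * (1 - s))).
    have -> : (fun s : R => l s + eta * (s * (1 - s))) =
        horner ((T (u x)) *: 'X + (T (u y)) *: (1 - 'X) + eta *: ('X * (1 - 'X))).
      by apply/funext => s; rewrite /l !hornerE; ring.
    exact: continuous_horner.
  have -> : h = (fun s => T (u (G s)) - (l s + eta * (s * (1 - s)))).
    by apply/funext => s; rewrite /h; ring.
  by move=> s; apply: cvgB; [exact: cTG|exact: (continuous_subspaceT cp)].
have [s0 s0in Hs0] := EVT_max ler01 ch.
rewrite in_itv/= in s0in.
have ht : 0 < h s0.
  apply: lt_le_trans (Hs0 t _); last by rewrite in_itv/=; lra.
  rewrite /h -/eta; case/andP: t01 => t0 t1.
  have : t * (1 - t) < 1 by nra.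
  by rewrite -(ltr_pM2l eta0) mulr1 subr_gt0.
have s01 : 0 < s0 < 1.
  have h0 : h 0 = 0 by rewrite /h /l /G !(scale0r, add0r, subr0, scale1r, mul0r, mul1r, mulr0) subrr.
  have h1 : h 1 = 0 by rewrite /h /l /G !(subrr, scale0r, addr0, subr0, scale1r, mul0r, mul1r, mulr0).
  have s0n0 : s0 != 0 by apply: contraTneq ht => ->; rewrite h0 ltxx.
  have s0n1 : s0 != 1 by apply: contraTneq ht => ->; rewrite h1 ltxx.
  by rewrite !lt_neqAle [0 == s0]eq_sym s0n0 s0n1.
(* The ends [x] and [y] may be boundary points; the shorter segment centred at [G s0] lies in
   [Omega]. *)
pose r := Num.min s0 (1 - s0) / 2.
have m0 : 0 < Num.min s0 (1 - s0) by rewrite lt_min subr_gt0.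
have ms : Num.min s0 (1 - s0) <= s0 by rewrite ge_min lexx.
have ms1 : Num.min s0 (1 - s0) <= 1 - s0 by rewrite ge_min lexx orbT.
have r0 : 0 < r by rewrite divr_gt0.
have Op : Omega (G (s0 + r)) by apply: sO => //; rewrite /r; lra.
have Om : Omega (G (s0 - r)) by apply: sO => //; rewrite /r; lra.
have GE w : w *: G (s0 + r) + (1 - w) *: G (s0 - r) = G (s0 + 2 * r * (w - 2^-1)).
  by rewrite /G; apply/rowP => i; rewrite !mxE; field.
have e0 : 0 < 4 * r ^+ 2 * eta by rewrite !mulr_gt0 ?exprn_gt0.
(* Under [s = s0 + 2 * r * (w - 2^-1)], the slope at [s0] is multiplied by [2 * r] and the curvature
   [eta] by [4 * r ^+ 2]. *)
apply: (@subsolution_not_concave u (G (s0 + r)) (G (s0 - r))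
  (2 * r * (T (u x) - T (u y) + eta * (1 - 2 * s0))) _ su Op Om e0) => w w01.
rewrite !GE subrr mulr0 addr0.
have := Hs0 (s0 + 2 * r * (w - 2^-1)) _; rewrite in_itv/=.
have rs : `|2 * r * (w - 2^-1)| <= r.
  have w2 : `|w - 2^-1| <= 2^-1 by rewrite ler_norml; lra.
  rewrite normrM (gtr0_norm (mulr_gt0 _ r0))//.
  by have := ler_wpM2l (ltW r0) w2; lra.
have {}rs : 0 <= s0 + 2 * r * (w - 2^-1) <= 1.
  by move: rs; rewrite ler_norml /r; lra.
move=> /(_ rs); rewrite /h /l; lra.
Qed.

Variable g : 'rV[R]_N -> R.
Hypothesis gcont : {within bd, continuous g}.
Notation env := (envelope alpha Omega g).

(** A maximum point [z0] of the affine function plus [eps |x - z|^2] minus [T \o u] must be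
    interior. There [T \o u] is touched from below by a strictly convex quadratic, and
    [linT_lower_test] turns this into a test function for [u] with [calL > 0]. *)
Lemma supersolution_ge_affine u c b z1 : {within cl, continuous u} ->
  viscosity_supersolution alpha Omega u ->
  (forall x, bd x -> affine c b z1 x <= T (u x)) ->
  forall z, Omega z -> affine c b z1 z <= T (u z).
Proof.
move=> cu [_ su] bl z Oz; rewrite leNgt; apply/negP => lt.
have cz := domain_closure Oz.
have [M0 M0_gt0 HM0] := closure_bounded bO.
have ball2 x y : cl x -> cl y -> `|x - y| <= 2 * M0.
  move=> /HM0 Hx /HM0 Hy; rewrite (le_trans (ler_normB _ _))//; lra.
pose B := N%:R * (2 * M0) ^+ 2.
have B0 : 0 <= B by rewrite mulr_ge0// exprn_ge0// mulr_ge0// ltW.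
have HB x y : cl x -> cl y -> dotp (x - y) (x - y) <= B.
  move=> cx cy; rewrite (le_trans (dotp_self_le _))// ler_wpM2l//.
  by rewrite lerXn2r ?nnegrE ?ball2 ?mulr_ge0// ltW.
pose eta := affine c b z1 z - T (u z).
have eta0 : 0 < eta by rewrite subr_gt0.
(* With [eps * B < eta] the quadratic term cannot bring a boundary value of [Psi] up to
   [Psi z = eta]. *)
pose eps := eta / (B + 1).
have B1 : 0 < B + 1 by rewrite ltr_wpDl.
have eps0 : 0 < eps by rewrite divr_gt0.
have epsB : eps * B < eta.
  have : eps * (B + 1) = eta by rewrite divfK// gt_eqF.
  lra.
pose Psi x := affine c b z1 x + eps * dotp (x - z) (x - z) - T (u x).
have cPsi : {within cl, continuous Psi}.
  have cTu := (within_continuous_linT alpha _ _).1 cu.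
  have -> : Psi = fun x => poly_quad ('X + (affine c b z1 z)%:P) b z eps x - T (u x).
    apply/funext => x; rewrite /Psi /poly_quad !hornerE /affine; congr (_ - _).
        by rewrite /= !dotpBr; ring.
  move=> x; apply: cvgB; last exact: cTu.
  exact: (continuous_subspaceT (@continuous_poly_quad _ _ _ _ _ _)).
have [z0 z0in Hz0] := compact_EVT_max (ex_intro _ z cz) (closure_compact bO) cPsi.
rewrite inE in z0in.
have {}Hz0 x : cl x -> Psi x <= Psi z0 by move=> cx; apply: Hz0; rewrite inE.
have Oz0 : Omega z0.
  have [//|bz0] := closure_case oO z0in.
  have := Hz0 z cz; rewrite /Psi subrr dotp0r mulr0 addr0 -/eta.
  have := ler_wpM2l (ltW eps0) (HB z0 z z0in cz); have := bl z0 bz0; lra.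
pose q := b + (2 * eps) *: (z0 - z).
pose X w := dotp q (w - z0) + eps * dotp (w - z0) (w - z0).
have touch w : cl w -> T (u z0) + X w <= T (u w).
  move=> cw; have := Hz0 w cw; rewrite /Psi /X /affine.
  have -> : w - z = (w - z0) + (z0 - z) by rewrite addrA subrK.
  have -> : w - z1 = (w - z0) + (z0 - z1) by rewrite addrA subrK.
  rewrite /q [dotp (b + _) _]dotpC; move: (w - z0) (z0 - z) (z0 - z1) => h k m.
  rewrite !dotpDr [dotp (h + k) h]dotpC [dotp (h + k) k]dotpC !dotpDr !dotpZr.
  by rewrite [dotp h b]dotpC [dotp k h]dotpC; lra.
set c0 := u z0 in touch; pose a := (D c0)^-1.
have a0 : 0 < a by rewrite invr_gt0 linD_gt0.
pose Q := dotp_bound q ^+ 2.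
have Q1 : 0 < Q + 1 by rewrite ltr_wpDl// sqr_ge0.
(* The error [d * dotp q v ^+ 2] then stays below [eps * a / 2] for every unit [v]. *)
pose d := eps * a / (2 * (Q + 1)).
have d0 : 0 < d by rewrite divr_gt0 ?(mulr_gt0 eps0 a0)// mulr_gt0.
have dQ : d * Q < eps * a / 2.
  have E : d * (2 * (Q + 1)) = eps * a by rewrite divfK// gt_eqF ?mulr_gt0.
  lra.
pose Xb := dotp_bound q * (2 * M0) + eps * B.
have M2 : 0 <= 2 * M0 by rewrite mulr_ge0// ltW.
have Xb0 : 0 <= Xb := addr_ge0 (mulr_ge0 (dotp_bound_ge0 q) M2) (mulr_ge0 (ltW eps0) B0).
have HX w : cl w -> `|X w| <= Xb.
  move=> cw; rewrite (le_trans (ler_normD _ _))// lerD//.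
    by rewrite (le_trans (dotp_le_bound _ _))// ler_wpM2l ?dotp_bound_ge0 ?ball2.
  by rewrite (ger0_norm (mulr_ge0 (ltW eps0) (dotp_ge0 _))) ler_wpM2l ?(ltW eps0)// HB.
(* The minimum of [u] is the level below which the polynomial may drop where [T c0 + X w] leaves the
   range of [T]. *)
have [m mcl Hm] := compact_EVT_min (ex_intro _ z cz) (closure_compact bO) cu.
have [K K0 HK] := linT_lower_test alpha c0 (u m) d0 Xb0.
set e := _ + d in HK.
pose P := test_poly c0 a e (- K).
have PE w : poly_quad P q z0 eps w = c0 + a * X w - e * X w ^+ 2 - K * X w ^+ 4.
  by rewrite /poly_quad horner_test_poly mulNr.
have := su z0 Oz0 (poly_quad P q z0 eps) (C2_on_poly_quad _ _ _ _ _).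
rewrite PE /X subrr !dotp0r mulr0 addr0 !expr0n/= !mulr0 !subr0 addr0 => /(_ erefl).
case/(_ _)/negP.
  move=> w Ow; have cw := domain_closure Ow; rewrite PE -(linT_le alpha).
  rewrite (le_trans (HK _ (HX w cw)))// ge_max touch//= linT_le.
  by apply: Hm; rewrite inE.
have al0 := alpha_gt0 halpha.
(* Pointwise positivity would not suffice for an infimum, hence the bound [alpha * (eps * a)],
   uniform in [v]. *)
apply/negP; rewrite -ltNge (lt_le_trans (mulr_gt0 al0 (mulr_gt0 eps0 a0)))//.
apply: le_calL => // v v1.
rewrite /ham hess_poly_quad grad_poly_quad deriv_test_poly0 deriv2_test_poly0 dotpZl.
have -> : dotp v v = 1.
  by rewrite -[dotp v v]sqr_sqrtr ?dotp_ge0// -/(enorm v) v1 expr1n.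
have -> : alpha * (- (2 * e) * dotp q v ^+ 2 + 2 * eps * a * 1) +
    (1 - alpha) * (a * dotp q v) ^+ 2 =
    alpha * (2 * (eps * a - d * dotp q v ^+ 2)).
  by rewrite /e -(alpha_kap halpha) -exprVn -/a; field.
have vQ : dotp q v ^+ 2 <= Q.
  by rewrite -real_normK ?num_real// lerXn2r ?nnegrE ?dotp_bound_ge0 ?dotp_enorm1.
have := ler_wpM2l (ltW d0) vQ => dvQ.
by rewrite (ler_pM2l al0); lra.
Qed.

Lemma env_dirichlet_solution : dirichlet_solution alpha Omega g env.
Proof.
have cenv := env_continuous N_gt0 halpha oO bO sO O0 gcont.
split=> //; last by move=> z bz; exact: (env_boundary N_gt0 halpha oO bO sO O0 gcont bz).
split; last exact: env_supersolution.
apply: alpha_convex_subsolution => //.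
  by apply: continuous_subspaceW cenv; exact: subset_closure.
exact/(alpha_convexP halpha)/env_convex.
Qed.

(** A solution is itself a competitor in the envelope. Conversely, the supporting affine function of
    [T \o env] at [z] lies below the data on the boundary, hence below [T \o u] in [Omega], and it
    equals [T (env z)] at [z]. *)
Lemma dirichlet_solution_unique u : dirichlet_solution alpha Omega g u ->
  forall z, cl z -> u z = env z.
Proof.
move=> [cu [su Su] ug] z cz.
have [Oz|bz] := closure_case oO cz; last first.
  by rewrite ug// (env_boundary N_gt0 halpha oO bO sO O0 gcont bz).
apply/eqP; rewrite eq_le; apply/andP; split.
  apply: (admissible_le_env N_gt0 halpha oO bO O0 gcont) => //.
  by split; [exact: subsolution_alpha_convex|move=> x bx; rewrite ug].
have cvx := env_convex N_gt0 halpha oO bO sO O0 gcont.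
have cvxO : convex_on Omega (T \o env).
  by move=> x y Ox Oy; apply: cvx; exact: domain_closure.
have [b Hb] := convex_subgradient oO (convex_dom_domain sO) cvxO Oz.
rewrite -(linT_le alpha).
have := @supersolution_ge_affine u (T (env z)) b z cu Su _ z Oz.
rewrite {2}/affine subrr dotp0r addr0; apply=> x bx.
rewrite ug// -(env_boundary N_gt0 halpha oO bO sO O0 gcont bx).
have [cx nx] := (boundaryE oO _).1 bx.
have xz : x != z by apply: contra_notN nx => /eqP ->.
(* The subgradient inequality is known only in [Omega]; applied at the midpoint of [x] and [z], it
   reaches the boundary point [x] through convexity on the closure. *)
have half01 : 0 < (2^-1 : R) < 1 by lra.
have := Hb _ (sO cx cz xz half01); have := cvx x z cx cz _ half01.
have -> : 2^-1 *: x + (1 - 2^-1) *: z - z = 2^-1 *: (x - z).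
  by apply/rowP => i; rewrite !mxE; field.
by rewrite dotpZr /affine /=; lra.
Qed.

End Uniqueness.

Theorem theorem1p5 (R : realType) (N : nat) (hN : (2 <= N)%N)
    (alpha : R) (halpha : 0 < alpha <= 1)
    (Omega : set 'rV[R]_N)
    (Odom : domain Omega) (Obnd : bounded_set Omega)
    (Oconv : strictly_convex Omega)
    (g : 'rV[R]_N -> R) (gcont : {within boundary Omega, continuous g}) :
  {within closure Omega, continuous (envelope alpha Omega g)} /\
  dirichlet_solution alpha Omega g (envelope alpha Omega g) /\
  forall u : 'rV[R]_N -> R, dirichlet_solution alpha Omega g u ->
    forall z, closure Omega z -> u z = envelope alpha Omega g z.
Proof.
have [oO _ O0] := Odom.
have N_gt0 : (0 < N)%N by exact: ltnW.
split; first exact: env_continuous.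
split; first exact: env_dirichlet_solution.
exact: dirichlet_solution_unique.
Qed.
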